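(* Assume that there exist a locally integrable function $\alpha:\mathbb{R}_{\ge 0}\to\mathbb{R}$, a function $V\in C^1(\mathbb{R}^d;\mathbb{R})$, and constants $a_1,a_2>0$, $r>1$, $M_1\ge 0$, $q\in(-\infty,1)$ such that $$a_1\|\xi\|^r\le V(\xi)\le a_2\|\xi\|^r\quad\forall \xi\in\mathbb{R}^d,$$ $$DV(\xi)F(t,\xi)\le \alpha(t)V(\xi)+M_1V(\xi)^q\quad \forall t\ge 0,\ \xi\in\mathbb{R}^d\setminus\{0\}.$$ Let $P_{\xi_0}$ be supported on a compact set $K\subset\mathbb{R}^d$. Let $\beta\in(0,1)$ and $p\ge 1$, and assume that one of the following two conditions holds: (a) $M_1>0$, there is $M_2>0$ with $\int_{t_1}^{t_2}\alpha(t)\,dt\le M_2$ for all $t_2\ge t_1\ge 0$, and $r(1-q)>\max\{2p,d\}$; or (b) $M_1=0$ and, for some $q'>0$ and $t_0>0$, $rq'>\max\{2p,d\}$ and $\int_0^t\alpha(s)\,ds\le \frac{\ln t}{q'}$ for all $t\ge t_0$. For every horizon $[0,T]$, consider sampling times $0=t_1\le t_2\le\dots\le t_{\bar N}=T$ (with $\bar N$ depending on $T$) such that $t_i-t_{i-1}\le\Delta$ for all $i\in\{2,\dots,\bar N\}$, where $\Delta>0$ is independent of $T$. Let $N=\bar N$, let $$\bar P^N_{\xi_T}:=\frac1N\sum_{i=1}^{N}\delta_{\Phi_{T,t_i}(\xi^i_{t_i})},\qquad \rho_T:=\tfrac12\operatorname{diam}(\Phi_T(K)).$$ Then $$\mathbb{P}\big(W_p(\bar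 P^N_{\xi_T},P_{\xi_T})\le\varepsilon_N(\beta,\rho_T)\big)\ge 1-\beta \quad\text{(for every horizon } T),$$ $$\lim_{T\to\infty}\varepsilon_N(\beta,\rho_T)=0.$$
   Context: Dynamics: $\dot\xi_t=F(t,\xi_t)$, $\xi_t\in\mathbb{R}^d$, where $F$ is continuous, locally Lipschitz in $\xi$, and the system is forward complete. For $t\ge s\ge 0$, $\Phi_{t,s}(\xi)$ denotes the value at time $t$ of the solution equal to $\xi$ at time $s$; $\Phi_t:=\Phi_{t,0}$. $DV(\xi)$ is the derivative of $V$. Random data: on a probability space $(\Omega,\mathcal F,\mathbb P)$, the initial conditions $\xi_0^i$, $i=1,\dots,\bar N$, are i.i.d. with law $P_{\xi_0}$; $\xi^i_t:=\Phi_t(\xi_0^i)$ are the corresponding independent trajectories, with common law $P_{\xi_t}:=\Phi_{t\#}P_{\xi_0}$ (pushforward). From trajectory $\xi^i$ the full-state sample $\xi^i_{t_i}$ is collected at the (deterministic) time $t_i$. $\|\cdot\|$ is the Euclidean norm, $\operatorname{diam}(S):=\sup\{\|x-y\|_\infty: x,y\in S\}$, and $W_p$ is the $p$-Wasserstein distance on probability measures on $\mathbb{R}^d$ with finite $p$-th moment, defined with the Euclidean cost $\|x-y\|^p$. Radius: let $C,c>0$ be constants depending only on $p$ and $d$ such that for every i.i.d. sequence $(X_i)$ in $\mathbb{R}^d$ with compactly supported law $\mu$, with $\rho:=\frac12\operatorname{diam}(\operatorname{supp}\mu)>0$ and $\widehat\mu^N:=\frac1N\sum_{i=1}^N\delta_{X_i}$,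 and all $N\ge1$, $\varepsilon>0$, one has $\mathbb P(W_p^p(\widehat\mu^N,\mu)\ge\varepsilon)\le\chi_N(\varepsilon,\rho)$, where $\chi_N(\varepsilon,\rho)$ equals $Ce^{-cN\varepsilon^2/\rho^{2p}}$ if $p>d/2$, $C\exp\big(-cN\frac{\varepsilon^2}{\rho^{2p}(\ln(2+\rho^p/\varepsilon))^2}\big)$ if $p=d/2$, and $Ce^{-cN\varepsilon^{d/p}/\rho^d}$ if $p<d/2$. Then $$\varepsilon_N(\beta,\rho):=\begin{cases}\left(\frac{\ln(C\beta^{-1})}{c}\right)^{\frac1{2p}}\frac{\rho}{N^{1/(2p)}}, & p>d/2,\\ \left[h^{-1}\left(\frac{\ln(C\beta^{-1})}{cN}\right)\right]^{\frac1p}\rho, & p=d/2,\\ \left(\frac{\ln(C\beta^{-1})}{c}\right)^{\frac1d}\frac{\rho}{N^{1/d}}, & p<d/2,\end{cases}$$ with $h^{-1}$ the inverse of $h(x)=\frac{x^2}{(\ln(2+1/x))^2}$, $x>0$. *)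

(* Defs.v *)
From mathcomp Require Export all_boot all_order all_algebra.
From mathcomp Require Export all_classical all_reals all_analysis.

Set Implicit Arguments.
Unset Strict Implicit.
Unset Printing Implicit Defensive.

Export Order.TTheory GRing.Theory Num.Theory.
Export numFieldNormedType.Exports.

Local Open Scope classical_set_scope.
Local Open Scope ring_scope.

(* Elements of R^d are row vectors.  The library norm `|x| on 'rV[R]_d is the
   sup norm; it is used for topology and for diam, while enorm is used in the
   Lyapunov bounds and in the transport cost. *)
Definition enorm (R : realType) (d : nat) (x : 'rV[R]_d) : R :=
  Num.sqrt (\sum_(j < d) x ord0 j ^+ 2).

Definition diam (R : realType) (d : nat) (S : set 'rV[R]_d) : R :=
  sup [set `|x - y| | x in S & y in S].

(* R^d with its Borel sigma-algebra (an alias of 'rV[R]_d) *)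
Definition borel (R : realType) (d : nat) :=
  g_sigma_algebraType (@open 'rV[R]_d).

(* Only the values of F at times t >= 0 are constrained. *)
Definition continuous_field (R : realType) (d : nat)
    (F : R -> 'rV[R]_d -> 'rV[R]_d) : Prop :=
  {within [set z : R * 'rV[R]_d | 0 <= z.1], continuous (fun z => F z.1 z.2)}.

(* The Lipschitz constant is locally uniform in t, as needed for uniqueness. *)
Definition locally_lipschitz_field (R : realType) (d : nat)
    (F : R -> 'rV[R]_d -> 'rV[R]_d) : Prop :=
  forall (t : R) (xi : 'rV[R]_d), 0 <= t ->
    exists (U : set R) (W : set 'rV[R]_d) (L : R),
      [/\ nbhs t U, nbhs xi W &
          forall s, U s -> 0 <= s -> L.-lipschitz_W (F s)].

(* At the initial time only continuity is required: since F is continuous, the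
   one-sided derivative at s is then automatically F s xi. *)
Definition is_solution (R : realType) (d : nat)
    (F : R -> 'rV[R]_d -> 'rV[R]_d) (s : R) (xi : 'rV[R]_d)
    (x : R -> 'rV[R]_d) : Prop :=
  [/\ x s = xi,
      {within `[s, +oo[, continuous x} &
      forall t, s < t -> is_derive t 1 x (F t (x t))].

Definition forward_complete (R : realType) (d : nat)
    (F : R -> 'rV[R]_d -> 'rV[R]_d) : Prop :=
  forall (s : R) (xi : 'rV[R]_d), 0 <= s -> exists x, is_solution F s xi x.

(* flow F t s xi is Phi_{t,s}(xi), for t >= s >= 0 *)
Definition flow (R : realType) (d : nat) (F : R -> 'rV[R]_d -> 'rV[R]_d)
    (t s : R) (xi : 'rV[R]_d) : 'rV[R]_d :=
  xget 0 [set y | exists2 x, is_solution F s xi x & x t = y].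

Definition locally_integrable_ge0 (R : realType) (alpha : R -> R) : Prop :=
  forall K : set R, compact K -> K `<=` `[0, +oo[ ->
    (@lebesgue_measure R).-integrable K (EFin \o alpha).

Definition grad (R : realType) (d : nat) (V : 'rV[R]_d -> R) (xi : 'rV[R]_d) :
    'rV[R]_d :=
  \row_j 'd V xi (delta_mx ord0 j).

Definition C1 (R : realType) (d : nat) (V : 'rV[R]_d -> R) : Prop :=
  (forall xi, differentiable V xi) /\ continuous (grad V).

Definition iid (R : realType) (d : nat) (dO : measure_display)
    (Omega : measurableType dO) (P : probability Omega R)
    (N : nat) (X : nat -> Omega -> borel R d)
    (mu : set (borel R d) -> \bar R) : Prop :=
  [/\ forall i, (i < N)%N -> measurable_fun setT (X i),
      forall i, (i < N)%N -> forall A, measurable A ->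
        pushforward P (X i) A = mu A &
      forall B : nat -> set (borel R d), (forall i, measurable (B i)) ->
        P [set w | forall i, (i < N)%N -> B i (X i w)] =
        (\prod_(i < N) P (X i @^-1` B i))%E].

Definition measure_support (R : realType) (d : nat)
    (mu : set (borel R d) -> \bar R) : set 'rV[R]_d :=
  [set x | forall U : set 'rV[R]_d, open U -> U x -> (0 < mu U)%E].

Definition empirical (R : realType) (d : nat) (N : nat)
    (x : nat -> borel R d) : set (borel R d) -> \bar R :=
  mscale (N%:R^-1)%:nng (msum (fun i => \d_(x i)) N).

Definition is_coupling (R : realType) (d : nat)
    (pi : probability (borel R d * borel R d)%type R)
    (mu nu : set (borel R d) -> \bar R) : Prop :=
  forall A : set (borel R d), measurable A ->
    pushforward pi fst A = mu A /\ pushforward pi snd A = nu A.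

Definition wasserstein (R : realType) (d : nat) (p : R)
    (mu nu : set (borel R d) -> \bar R) : \bar R :=
  (ereal_inf
     [set (\int[pi]_z (enorm ((z.1 : 'rV[R]_d) - z.2) `^ p)%:E)%E
     | pi in [set pi : probability (borel R d * borel R d)%type R |
              is_coupling pi mu nu]] `^ p^-1)%E.

Definition chi (R : realType) (d : nat) (p C c : R) (N : nat) (eps rho : R) :
    R :=
  if p > d%:R / 2 then
    C * expR (- (c * N%:R * (eps ^+ 2 / rho `^ (2 * p))))
  else if p == d%:R / 2 then
    C * expR (- (c * N%:R *
      (eps ^+ 2 / (rho `^ (2 * p) * ln (2 + rho `^ p / eps) ^+ 2))))
  else
    C * expR (- (c * N%:R * (eps `^ (d%:R / p) / rho ^+ d))).

(* Since the bound only involves X_0, ..., X_{N-1}, only these are required to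
   be i.i.d. *)
Definition concentration (R : realType) (d : nat) (p C c : R) : Prop :=
  forall (dO : measure_display) (Omega : measurableType dO)
    (P : probability Omega R) (mu : probability (borel R d) R)
    (N : nat) (X : nat -> Omega -> borel R d) (eps : R),
  let rho := diam (measure_support mu) / 2 in
  (0 < N)%N -> iid P N X mu -> compact (measure_support mu) -> 0 < rho -> 0 < eps ->
  (P [set w | eps%:E <=
        wasserstein p (empirical N (fun i => X i w)) mu `^ p] <=
   (chi d p C c N eps rho)%:E)%E.

Definition hfun (R : realType) (x : R) : R := x ^+ 2 / ln (2 + x^-1) ^+ 2.

Definition hinv (R : realType) : R -> R :=
  'pinv_(fun=> 0) [set x : R | 0 < x] (@hfun R).

Definition ambiguity_radius (R : realType) (d : nat) (p C c : R) (N : nat)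
    (beta rho : R) : R :=
  if p > d%:R / 2 then
    (ln (C * beta^-1) / c) `^ (2 * p)^-1 * (rho / N%:R `^ (2 * p)^-1)
  else if p == d%:R / 2 then
    hinv (ln (C * beta^-1) / (c * N%:R)) `^ p^-1 * rho
  else
    (ln (C * beta^-1) / c) `^ (d%:R)^-1 * (rho / N%:R `^ (d%:R)^-1).

(* tau i is the (i+1)-st sampling time t_{i+1} *)
Definition sampling_times (R : realType) (T Delta : R) (N : nat)
    (tau : nat -> R) : Prop :=
  [/\ (0 < N)%N, tau 0%N = 0, tau N.-1 = T &
      forall i, (i.+1 < N)%N ->
        tau i <= tau i.+1 /\ tau i.+1 - tau i <= Delta].

(* Main.v *)
From HB Require Import structures.
Require Import Defs.
From mathcomp Require Import all_boot all_order all_algebra.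
From mathcomp Require Import all_classical all_reals all_analysis.
From mathcomp Require Import measurable_realfun ring lra.
Import Order.TTheory GRing.Theory Num.Theory.
Import numFieldNormedType.Exports.
Set Implicit Arguments.
Unset Strict Implicit.
Unset Printing Implicit Defensive.
Local Open Scope classical_set_scope.
Local Open Scope ring_scope.

(** The proof separates the statistics from the dynamics.

For the probability bound, uniqueness of solutions gives the semigroup property
[flow_semigroup], so flowing the state sampled at time [t_i] forward to [T]
yields exactly the image under the flow of the [i]-th initial condition.  The
propagated samples are therefore an i.i.d. sample of the law at time [T], which
is carried by the compact image of [K].  The concentration inequality holds
with the half-diameter of the support of that law, which is at most that of the
image of [K], and the radius is defined as the level at which the
concentration bound equals [beta] ([chi_le]); this is [concentration_radius].
Two measurability facts enter.  The flow is continuous in the initial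
condition ([flow_continuous]), by a Gronwall estimate inside a tube around one
trajectory on which the field has a uniform Lipschitz constant.  The
Wasserstein distance of the empirical measure to a fixed law is a random
variable because, among samples with the same coincidences, the transport cost
is upper semicontinuous in the sample points ([transport_cost_usc]): a plan is
carried along by a map moving each sample point a little, and Minkowski's
inequality controls its cost.

For the limit, gaps of at most [Delta] force [T <= Delta * N], so the radius is
at most of order [rho_T * T^(-1/m)], where [m] is [2p] or [d] according to the
regime and an arbitrarily small power is lost when [p = d/2].  It remains to see that
[rho_T] is bounded by a power [T^k] with [k * max(2p, d) < 1] ([rho_growth]).
Along a trajectory on which [V] is positive, [ln V] is continuously
differentiable with derivative at most [alpha + M1 V^(q-1)], and this is
integrated directly.  In the forced case the integration starts at the last
time at which [V <= (1+T)^(1/(1-q))]; from then on the forcing contributes at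
most [M1], so that [V] is at most of order [T^(1/(1-q))] at [T].  In the unforced
case it starts at time [0] and [V] is at most of order [T^(1/q')].  Dividing the
exponents by [r] gives the growth of the norm. *)

(** * Scalar differential inequalities *)

Section scalar.
Context {R : realType}.
Implicit Types (f E : R -> R) (a b c k D t : R).

Lemma compact_superlevel f a b c : {within `[a, b], continuous f} ->
  compact [set t | a <= t <= b /\ c <= f t].
Proof.
move=> fc; have := @closed_ge R c => /(proj1 (continuous_closedP _) fc).
move=> /closed_subspaceP[Vc cV VE].
have -> : [set t | a <= t <= b /\ c <= f t] = Vc `&` `[a, b].
  rewrite VE; apply/seteqP; split => t /=; rewrite in_itv/= => -[]//.
by rewrite setIC; apply: compact_closedI => //; exact: segment_compact.
Qed.

Lemma compact_has_min (A : set R) : A !=set0 -> compact A ->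
  exists2 t, A t & forall s, A s -> t <= s.
Proof.
move=> A0 cA; have [|t /set_mem At tmin] := @compact_EVT_min _ _ (idfun : R -> R) _ A0 cA.
  by apply: continuous_subspaceT => x; exact: cvg_id.
by exists t => // s As; exact/tmin/mem_set.
Qed.

Lemma compact_has_max (A : set R) : A !=set0 -> compact A ->
  exists2 t, A t & forall s, A s -> s <= t.
Proof.
move=> A0 cA; have [|t /set_mem At tmax] := @compact_EVT_max _ _ (idfun : R -> R) _ A0 cA.
  by apply: continuous_subspaceT => x; exact: cvg_id.
by exists t => // s As; exact/tmax/mem_set.
Qed.

(** The product of [E t] and [expR (- k (t - a))] has nonpositive derivative. *)
Lemma gronwall E a b k : a <= b -> {within `[a, b], continuous E} ->
  (forall t, a < t < b -> derivable E t 1 /\ 'D_1 E t <= k * E t) ->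
  E b <= E a * expR (k * (b - a)).
Proof.
move=> ab Ec dE.
pose g t := expR (- (k * (t - a))).
have dg t : is_derive t 1 g (- k * g t).
  have dl : is_derive t 1 (fun t => - (k * (t - a)) : R) (- k).
    have : is_derive t 1 (fun t => - k * (t - a) : R) (- k * (1 - 0)).
      by apply: is_deriveZ.
    by rewrite subr0 mulr1; under eq_fun do rewrite mulNr.
  rewrite mulrC.
  exact: (@is_derive1_comp _ expR (fun t => - (k * (t - a))) _ _ _ _ dl).
have gd t : derivable g t 1 by exact: (@ex_derive _ _ _ _ _ _ _ (dg t)).
have gv t : 'D_1 g t = - k * g t by exact: (@derive_val _ _ _ _ _ _ _ (dg t)).
have g0 t : 0 < g t by exact: expR_gt0.
have ga : g a = 1 by rewrite /g subrr mulr0 oppr0 expR0.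
have gb : expR (k * (b - a)) = (g b)^-1 by rewrite /g expRN invrK.
rewrite gb -ler_pdivrMr// {gb}; last by rewrite invr_gt0.
rewrite invrK -[leRHS]mulr1 -ga.
move: g gd gv g0 {dg ga} => g gd gv g0.
apply: (@ler0_derive1_le_cc R (fun t => E t * g t) a b) => //;
  rewrite ?in_itv/= ?lexx ?ab//.
- move=> t; rewrite in_itv/= => tab; apply: derivableM; last exact: gd.
  by have [] := dE _ tab.
- move=> t; rewrite in_itv/= => tab; have [h1 h2] := dE _ tab.
  rewrite derive1E (deriveM h1 (gd t)) gv /GRing.scale/=.
  by have := g0 t; nra.
- move=> t; apply: cvgM; first exact: Ec.
  have : {within `[a, b], continuous g}.
    apply: continuous_subspaceT => x; apply/differentiable_continuous.
    exact/derivable1_diffP/gd.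
  exact.
Qed.

(** If the bound [E' <= k E] is only known below the level [D], and the
exponential estimate itself stays below [D], then at the first time at which
[E] would reach [D] the estimate still applies, so [E] never gets there. *)
Lemma gronwall_below E a b k D : 0 <= k -> 0 <= E a ->
  {within `[a, b], continuous E} ->
  (forall t, a < t < b -> E t < D ->
     derivable E t 1 /\ 'D_1 E t <= k * E t) ->
  E a * expR (k * (b - a)) < D ->
  forall t, a <= t <= b -> E t <= E a * expR (k * (t - a)).
Proof.
move=> k0 Ea0 Ec dE ED.
have sub s : a <= s <= b -> {within `[a, s], continuous E}.
  move=> /andP[_ sb]; apply: continuous_subspaceW Ec => x /=.
  by rewrite !in_itv/= => /andP[-> /le_trans]; apply.
have below t : a <= t <= b -> E t < D.
  apply: contraPP => /negP; rewrite -leNgt => Dt tab.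
  have [s [/andP[sa sb] Ds] smin] :=
    compact_has_min (ex_intro _ t (conj tab Dt)) (compact_superlevel (c := D) Ec).
  have : E s <= E a * expR (k * (s - a)).
    apply: gronwall => // [|u /andP[au us]]; first by apply: sub; rewrite sa.
    apply: dE; first by rewrite au (lt_le_trans us).
    rewrite ltNge; apply/negP => Du.
    suff /smin : [set t | a <= t <= b /\ D <= E t] u by rewrite leNgt us.
    by split=> //; rewrite (ltW au) (le_trans (ltW us)).
  move=> Es; suff : E s < D by rewrite ltNge Ds.
  apply: le_lt_trans Es (le_lt_trans _ ED).
  by rewrite ler_wpM2l// ler_expR ler_wpM2l// lerD2r.
move=> t /andP[a_t tb]; apply: gronwall => //; first by apply: sub; rewrite a_t.
move=> s /andP[a_s st]; have sb := lt_le_trans st tb.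
by apply: dE; [rewrite a_s|apply: below; rewrite !ltW].
Qed.

(** At the last time at which [f <= c], continuity also gives the reverse
inequality, so that [c <= f] holds on the whole remaining closed interval. *)
Lemma last_time_below f a b c : a <= b -> {within `[a, b], continuous f} ->
  exists s, [/\ a <= s <= b, s = a \/ f s <= c &
    s < b -> forall t, s <= t <= b -> c <= f t].
Proof.
move=> ab fc; pose S := [set t | a <= t <= b /\ - c <= - f t].
have cS : compact S.
  by apply: compact_superlevel => x; apply: cvgN; exact: fc.
have [s [/andP[a_s sb] fs above]] : exists s, [/\ a <= s <= b, s = a \/ f s <= c &
    forall t, s < t <= b -> c < f t].
  have [[t0 St0]|S0] := pselect (S !=set0).
    have [s [sab]] := compact_has_max (ex_intro _ t0 St0) cS.
    rewrite lerN2 => fs smax; exists s; split => //; first by right.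
    move=> t /andP[st tb]; rewrite ltNge; apply/negP => ft.
    suff /smax : S t by rewrite leNgt st.
    split; last by rewrite lerN2.
    by rewrite tb (le_trans _ (ltW st))//; case/andP: sab.
  exists a; split; [by rewrite lexx ab|by left|] => t /andP[a_t tb].
  rewrite ltNge; apply/negP => ft; apply: S0; exists t.
  by split; [rewrite ltW//= tb|rewrite lerN2].
exists s; split=> //; first by rewrite a_s.
move=> ltsb t /andP[st tb].
have [s_t|] := ltP s t; first by rewrite ltW// above// s_t.
move=> ts; have -> : t = s by apply/eqP; rewrite eq_le ts st.
have fcs : {within `[s, b], continuous f}.
  apply: continuous_subspaceW fc => x /=.
  by rewrite !in_itv/= => /andP[sx ->]; rewrite (le_trans a_s sx).
have [|m [/andP[sm mb] fm] mmin] :=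
  compact_has_min _ (compact_superlevel (c := c) fcs).
  by exists b; rewrite /= ltW// lexx ltW// above// ltsb lexx.
suff -> : s = m by [].
apply/eqP; rewrite eq_le sm/=; apply/ler_addgt0Pr => e e0.
have := mmin (Num.min b (s + e)); rewrite /= => /(_ _)/le_trans; apply.
  rewrite le_min ltW//= lerDl (ltW e0) ge_min lexx/=; split=> //.
  by rewrite ltW// above// lt_min ltsb ltrDl e0/= ge_min lexx.
by rewrite ge_min lexx orbT.
Qed.

End scalar.

Lemma le_powR_inv {R : realType} (x y r : R) : 0 <= x -> 0 < r ->
  x `^ r <= y -> x <= y `^ r^-1.
Proof.
move=> x0 r0 xy; have rV : r * r^-1 = 1 by rewrite mulfV// gt_eqF.
rewrite -[leLHS](powRr1 x0) -rV powRrM.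
apply: ge0_ler_powR; rewrite ?nnegrE ?powR_ge0 ?invr_ge0 ?(ltW r0)//.
exact: le_trans (powR_ge0 _ _) xy.
Qed.

Lemma powR_invK {R : realType} (x m : R) : 0 <= x -> m != 0 ->
  (x `^ m^-1) `^ m = x.
Proof. by move=> x0 m0; rewrite -powRrM mulVf// powRr1. Qed.

Lemma powR_div {R : realType} (x y m : R) : 0 <= x -> 0 <= y ->
  (x / y) `^ m = x `^ m / y `^ m.
Proof.
move=> x0 y0; rewrite powRM ?invr_ge0//; congr (_ * _).
by rewrite -powR_inv1// -!powRrM mulN1r powRN.
Qed.

(** * Norms and diameters in finite dimension *)

Section vectors.
Context {R : realType} {d : nat}.
Implicit Types (x y z : 'rV[R]_d) (S : set 'rV[R]_d).

(** Along a trajectory the square of the Euclidean norm is differentiable even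
where it vanishes, so distances between solutions are measured with it. *)
Definition sqnorm x : R := \sum_(j < d) x ord0 j ^+ 2.

Lemma sqnorm_ge0 x : 0 <= sqnorm x.
Proof. by apply: sumr_ge0 => j _; exact: sqr_ge0. Qed.

Lemma coord_le_norm x j : `|x ord0 j| <= `|x|.
Proof.
by rewrite {2}/Num.norm/= mx_normrE; exact: (le_bigmax _ _ (ord0, j)).
Qed.

Lemma sqr_norm_le x : `|x| ^+ 2 <= sqnorm x.
Proof.
have [->|x0] := eqVneq `|x| 0; first by rewrite expr0n sqnorm_ge0.
have [[i j] /=] := mx_norm_neq0 x0.
rewrite (ord1 i) => xj; have -> : `|x| = `|x ord0 j| by exact: xj.
rewrite real_normK ?num_real//.
by rewrite /sqnorm (bigD1 j)//= lerDl sumr_ge0// => k _; exact: sqr_ge0.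
Qed.

Lemma sqnorm_le x : sqnorm x <= d%:R * `|x| ^+ 2.
Proof.
apply: (@le_trans _ _ (\sum_(j < d) `|x| ^+ 2)).
  apply: ler_sum => j _; rewrite -[leLHS]real_normK ?num_real//.
  by rewrite lerXn2r ?nnegrE// coord_le_norm.
by rewrite sumr_const card_ord mulr_natl.
Qed.

Lemma sqnorm_eq0 x : sqnorm x <= 0 -> x = 0.
Proof.
move=> x0; apply/eqP; rewrite -normr_eq0 -sqrf_eq0 eq_le sqr_ge0 andbT.
exact: le_trans (sqr_norm_le x) x0.
Qed.

Lemma sqnorm_continuous : continuous (sqnorm : 'rV[R]_d -> R).
Proof.
rewrite /sqnorm; apply: continuous_big => [|j _ x]; first exact: add_continuous.
have cj := @coord_continuous R 1 d ord0 j x; exact: (cvgM cj cj).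
Qed.

Lemma sqnorm0 : sqnorm (0 : 'rV[R]_d) = 0.
Proof. by rewrite /sqnorm big1// => j _; rewrite mxE expr0n. Qed.

Lemma near_sqnorm_lt x (c e : R) : 0 < e ->
  \forall y \near x, sqnorm (x - y) * c < e.
Proof.
move=> e0; set k := d%:R * `|c|; have k0 : 0 <= k by rewrite mulr_ge0.
have del0 : 0 < Num.min 1 (e / (k + 1)).
  by rewrite lt_min ltr01 divr_gt0// ltr_wpDl.
apply/nbhs_ballP; exists (Num.min 1 (e / (k + 1))) => //= y.
rewrite -ball_normE/= lt_min => /andP[xy1 xye].
apply: (@le_lt_trans _ _ (k * `|x - y|)).
  apply: (@le_trans _ _ (sqnorm (x - y) * `|c|)).
    by rewrite ler_wpM2l ?sqnorm_ge0// ler_norm.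
  rewrite /k mulrAC ler_wpM2r// (le_trans (sqnorm_le _))// ler_wpM2l//.
  by rewrite expr2 ler_piMl// ltW.
rewrite (@le_lt_trans _ _ ((k + 1) * `|x - y|))//; last first.
  by rewrite mulrC -ltr_pdivlMr// ltr_wpDl.
by rewrite ler_wpM2r// lerDl.
Qed.

Lemma enorm_ge0 x : 0 <= enorm x.
Proof. exact: sqrtr_ge0. Qed.

Lemma sqr_enorm x : enorm x ^+ 2 = sqnorm x.
Proof. exact/sqr_sqrtr/sqnorm_ge0. Qed.

Lemma enorm_le x : enorm x <= Num.sqrt d%:R * `|x|.
Proof.
rewrite -(@ler_pXn2r _ 2)// ?nnegrE ?enorm_ge0 ?mulr_ge0 ?sqrtr_ge0//.
by rewrite sqr_enorm exprMn sqr_sqrtr// sqnorm_le.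
Qed.

(** Expand [0 <= \sum_j (b x_j - a y_j)^2] for [a = enorm x] and [b = enorm y]. *)
Lemma cauchy_schwarz x y :
  \sum_(j < d) x ord0 j * y ord0 j <= enorm x * enorm y.
Proof.
have [x0|x0] := eqVneq (enorm x) 0.
  have -> : x = 0 by apply: sqnorm_eq0; rewrite -sqr_enorm x0 expr0n.
  by rewrite big1 ?mulr_ge0 ?enorm_ge0// => j _; rewrite mxE mul0r.
have [y0|y0] := eqVneq (enorm y) 0.
  have -> : y = 0 by apply: sqnorm_eq0; rewrite -sqr_enorm y0 expr0n.
  by rewrite big1 ?mulr_ge0 ?enorm_ge0// => j _; rewrite mxE mulr0.
set a := enorm x in x0 *; set b := enorm y in y0 *.
have ab0 : 0 < a * b by rewrite mulr_gt0// lt_neqAle eq_sym ?x0 ?y0 enorm_ge0.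
have : 0 <= \sum_(j < d) (b * x ord0 j - a * y ord0 j) ^+ 2.
  by apply: sumr_ge0 => j _; exact: sqr_ge0.
have -> : \sum_(j < d) (b * x ord0 j - a * y ord0 j) ^+ 2 =
    b ^+ 2 * sqnorm x - 2 * (a * b) * (\sum_(j < d) x ord0 j * y ord0 j) +
    a ^+ 2 * sqnorm y.
  rewrite /sqnorm !mulr_sumr -sumrB -big_split/=; apply: eq_bigr => j _.
  by ring.
rewrite -!sqr_enorm -/a -/b => h.
rewrite -subr_ge0 -(pmulr_rge0 _ ab0) -(pmulr_rge0 _ (ltr0n R 2)).
by apply: le_trans h _; rewrite le_eqVlt; apply/orP; left; apply/eqP; ring.
Qed.

Lemma enormD x y : enorm (x + y) <= enorm x + enorm y.
Proof.
rewrite -(@ler_pXn2r _ 2)// ?nnegrE ?addr_ge0 ?enorm_ge0//.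
have -> : enorm (x + y) ^+ 2 =
    sqnorm x + 2 * (\sum_(j < d) x ord0 j * y ord0 j) + sqnorm y.
  rewrite sqr_enorm /sqnorm mulr_sumr -!big_split/=; apply: eq_bigr => j _.
  by rewrite mxE; ring.
rewrite sqrrD !sqr_enorm lerD2r lerD2l -[leRHS]mulr_natl ler_pM2l//.
exact: cauchy_schwarz.
Qed.

Lemma enorm_triangle x y z : enorm (x - z) <= enorm (x - y) + enorm (y - z).
Proof. by rewrite -(subrKA y) enormD. Qed.

Lemma norm_le_enorm x : `|x| <= enorm x.
Proof.
by rewrite -[leLHS]normr_id -sqrtr_sqr ler_wsqrtr// sqr_norm_le.
Qed.

Lemma enorm0 : enorm (0 : 'rV[R]_d) = 0.
Proof. by rewrite /enorm big1 ?sqrtr0// => j _; rewrite mxE expr0n. Qed.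

Lemma compact_bounded_above (K : set 'rV[R]_d) (f : 'rV[R]_d -> R) :
  compact K -> continuous f -> exists2 B, 0 <= B & forall x, K x -> f x <= B.
Proof.
move=> cK fc; have [[x0 Kx0]|K0] := pselect (K !=set0); last first.
  by exists 0 => // x Kx; exfalso; apply: K0; exists x.
have [c _ cmax] := compact_EVT_max (ex_intro _ x0 Kx0) cK (continuous_subspaceT fc).
exists (Num.max 0 (f c)); first by rewrite le_max lexx.
by move=> x Kx; rewrite le_max cmax ?orbT// inE.
Qed.

Let dists S : set R := [set `|x - y| | x in S & y in S].

Lemma compact_norm_bounded S : compact S -> exists2 B, 0 <= B & forall x, S x -> `|x| <= B.
Proof. by move=> cS; apply: compact_bounded_above => //; exact: norm_continuous. Qed.

Lemma has_ubound_dists S : compact S -> has_ubound (dists S).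
Proof.
move=> /compact_norm_bounded[B B0 SB]; exists (B + B) => _ [x Sx [y Sy <-]].
by rewrite (le_trans (ler_normB _ _))// lerD// SB.
Qed.

Lemma norm_le_diam S x y : compact S -> S x -> S y -> `|x - y| <= diam S.
Proof.
move=> cS Sx Sy; apply: ub_le_sup; first exact: has_ubound_dists.
by exists x => //; exists y.
Qed.

Lemma diam_set0 : diam (set0 : set 'rV[R]_d) = 0.
Proof.
rewrite /diam (_ : [set _ | _ in _ & _ in _] = set0) ?sup0//.
by apply/seteqP; split=> // ? [? []].
Qed.

Lemma diam_ge0 S : compact S -> 0 <= diam S.
Proof.
move=> cS; have [->|/set0P[x Sx]] := eqVneq S set0; first by rewrite diam_set0.
exact: le_trans (norm_le_diam cS Sx Sx).
Qed.

Lemma le_diam S S' : compact S' -> S `<=` S' -> diam S <= diam S'.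
Proof.
move=> cS' SS'; have [->|/set0P[x Sx]] := eqVneq S set0.
  by rewrite diam_set0 diam_ge0.
apply: ge_sup => [|_ [u Su [v Sv <-]]]; first by exists `|x - x|, x => //; exists x.
by apply: norm_le_diam => //; exact: SS'.
Qed.

Lemma diam_le S B : 0 <= B -> (forall x, S x -> `|x| <= B) -> diam S / 2 <= B.
Proof.
move=> B0 SB; rewrite ler_pdivrMr// /diam.
set D := [set _ | _ in _ & _ in _].
have [D0|D0] := pselect (D !=set0); last first.
  by rewrite (_ : D = set0) ?sup0 ?mulr_ge0//; apply: contra_notP D0 => /eqP/set0P.
apply: ge_sup => // _ [x Sx [y Sy <-]].
by rewrite (le_trans (ler_normB _ _))// mulr_natr mulr2n lerD// SB.
Qed.

End vectors.

(** * The flow *)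

Section flow.
Context {R : realType} {d : nat} (F : R -> 'rV[R]_d -> 'rV[R]_d).
Implicit Types (xi : 'rV[R]_d) (x y : R -> 'rV[R]_d) (s t T u : R).

Lemma is_solutionW s u xi x : s <= u -> is_solution F s xi x ->
  is_solution F u (x u) x.
Proof.
move=> su [_ xc dx]; split => //; last by move=> t ut; apply/dx/le_lt_trans/ut.
by apply: continuous_subspaceW xc => t /=; rewrite !in_itv/= !andbT; exact: le_trans.
Qed.

Hypothesis lipF : locally_lipschitz_field F.

(** Covering the compact piece of trajectory by the neighbourhoods of local
Lipschitz continuity gives one radius and one constant; taking both as functions
of a single integer [n] lets compactness be used for the filter of large [n]. *)
Lemma lipschitz_tube s T xi x : 0 <= s -> is_solution F s xi x ->
  exists n : nat, forall t, s <= t <= T -> forall y z : 'rV[R]_d,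
    `|x t - y| < n.+1%:R^-1 -> `|x t - z| < n.+1%:R^-1 ->
    `|F t y - F t z| <= n.+1%:R * `|y - z|.
Proof.
move=> s0 [_ /subspace_continuousP xc _].
pose P (n : nat) t := forall y z : 'rV[R]_d,
    `|x t - y| < n.+1%:R^-1 -> `|x t - z| < n.+1%:R^-1 ->
    `|F t y - F t z| <= n.+1%:R * `|y - z|.
suff [n Pn] : exists n, `[s, T] `<=` P n.
  by exists n => t sT; apply: Pn; rewrite /= in_itv.
suff : \forall n \near \oo, `[s, T] `<=` P n by move=> /filter_ex.
have /compact_near_coveringP/near_covering_withinP := @segment_compact R s T.
apply => t0; rewrite /= in_itv/= => /andP[st0 t0T].
have [U [W [L [Ut0 Wx lipU]]]] := lipF (x t0) (le_trans s0 st0).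
have /nbhs_ballP[e /= e0 eW] := Wx.
have e20 : 0 < e / 2 by rewrite divr_gt0.
have := xc t0; rewrite /= in_itv/= st0 => /(_ isT)/cvgrPdist_lt/(_ _ e20).
rewrite near_withinE => xe.
near=> t n => /=; rewrite in_itv/= => /andP[st tT] y z xy xz.
have xt0 : `|x t0 - x t| < e / 2.
  by apply: (near xe t) => //; rewrite /= in_itv/= st.
have ne : n.+1%:R^-1 < e / 2.
  near: n; exact: (near_infty_natSinv_lt (PosNum e20)).
have nL : L <= n.+1%:R.
  rewrite -natr1; apply: ler_wpDr => //.
  by near: n; exact: nbhs_infty_ger.
have inW v : `|x t - v| < n.+1%:R^-1 -> W v.
  move=> xv; apply: eW; rewrite -ball_normE/= -(subrKA (x t)).
  by rewrite (le_lt_trans (ler_normD _ _))// (splitr e) ltrD// (lt_trans xv).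
have Ut : U t by near: t.
have /(_ (y, z)) := lipU t Ut (le_trans s0 st).
rewrite /= => /(_ (conj (inW _ xy) (inW _ xz))) /le_trans; apply.
by rewrite ler_wpM2r.
Unshelve. all: by end_near. Qed.

Lemma is_derive_coord (x : R -> 'rV[R]_d) t v j : is_derive t 1 x v ->
  is_derive t 1 (fun s => x s ord0 j : R) (v ord0 j).
Proof.
move=> [dx xv]; have dxj := (derivable_mxP _ _ _).1 dx ord0 j.
by apply: DeriveDef => //; rewrite -xv derive_mx// mxE.
Qed.

Lemma is_derive_sqnorm (x : R -> 'rV[R]_d) t v : is_derive t 1 x v ->
  is_derive t 1 (fun s => sqnorm (x s)) (\sum_(j < d) 2 * x t ord0 j * v ord0 j).
Proof.
move=> xv.
have -> : (fun s => sqnorm (x s)) =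
    \sum_(j < d) (fun s => x s ord0 j ^+ 2 : R).
  by apply/funext => s; rewrite fct_sumE.
apply: is_derive_sum => j.
exact: (@is_deriveX _ _ (fun s => x s ord0 j : R) 2 t 1 _ (is_derive_coord j xv)).
Qed.

(** The squared distance [E] of two solutions satisfies [E' <= k E] as long as
the second solution stays in the tube around the first; a small initial
distance keeps it there up to time [T] by [gronwall_below]. *)
Lemma solution_stable s T xi x : 0 <= s -> is_solution F s xi x ->
  exists k D : R, [/\ 0 <= k, 0 < D & forall xi' (y : R -> 'rV[R]_d), is_solution F s xi' y ->
    sqnorm (xi - xi') * expR (k * (T - s)) < D -> forall t, s <= t <= T ->
    sqnorm (x t - y t) <= sqnorm (xi - xi') * expR (k * (t - s))].
Proof.
move=> s0 solx; have [n tube] := lipschitz_tube T s0 solx.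
have [xs xc dx] := solx.
exists (2 * d%:R * n.+1%:R), (n.+1%:R^-1 ^+ 2); split => //.
move=> xi' y [ys yc dy] close t stT.
rewrite -xs -ys in close *.
apply: (gronwall_below (E := fun t => sqnorm (x t - y t)) _ _ _ _ close) => //.
- exact: sqnorm_ge0.
- move=> u; have : {within `[s, T], continuous (fun t => x t - y t)}.
    have sub : `[s, T] `<=` `[s, +oo[ by apply: subset_itvl; rewrite bnd_simp.
    move=> v; apply: cvgB; move: v.
      exact: (continuous_subspaceW sub xc).
    exact: (continuous_subspaceW sub yc).
  move=> /(_ u) xy; apply: (continuous_comp xy).
  exact: sqnorm_continuous.
- move=> u /andP[su uT] uD.
  have dE := is_derive_sqnorm (is_deriveB (dx u su) (dy u su)).
  split; first exact: (@ex_derive _ _ _ _ _ _ _ dE).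
  rewrite (@derive_val _ _ _ _ _ _ _ dE).
  set z := x u - y u in uD *; set w := F u (x u) - F u (y u).
  have zn : `|z| < n.+1%:R^-1.
    by rewrite -(@ltr_pXn2r _ 2)// ?nnegrE ?invr_ge0// (le_lt_trans (sqr_norm_le z)).
  have wz : `|w| <= n.+1%:R * `|z|.
    by apply: tube => //; [rewrite !ltW|rewrite subrr normr0 invr_gt0].
  apply: (@le_trans _ _ (\sum_(j < d) 2 * n.+1%:R * `|z| ^+ 2)).
    apply: ler_sum => j _; rewrite -[(x - y) u]/z -!mulrA ler_pM2l//.
    apply: le_trans (ler_norm _) _; rewrite normrM.
    apply: (@le_trans _ _ (`|z| * `|w|)); first by rewrite ler_pM// coord_le_norm.
    by rewrite expr2 mulrCA ler_wpM2l.
  rewrite sumr_const card_ord -[leLHS]mulr_natl [2 * d%:R]mulrC -!mulrA.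
  by rewrite !ler_wpM2l// sqr_norm_le.
Qed.

Lemma solution_unique s xi x y : 0 <= s -> is_solution F s xi x ->
  is_solution F s xi y -> forall t, s <= t -> x t = y t.
Proof.
move=> s0 solx soly t st; have [k [D [_ D0 stab]]] := solution_stable t s0 solx.
have := stab _ _ soly; rewrite subrr.
rewrite sqnorm0 mul0r => /(_ D0 t); rewrite st lexx => /(_ isT).
by rewrite mul0r => /sqnorm_eq0/eqP; rewrite subr_eq0 => /eqP.
Qed.

Lemma flowE s t xi x : 0 <= s -> s <= t -> is_solution F s xi x ->
  flow F t s xi = x t.
Proof.
move=> s0 st solx; rewrite /flow.
have /xgetPex /= /(_ 0)[y soly <-] :
  exists z, [set y | exists2 x, is_solution F s xi x & x t = y] z.
  by exists (x t), x.
exact: solution_unique soly solx _ st.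
Qed.

Hypothesis completeF : forward_complete F.

Lemma flow_semigroup s t u xi : 0 <= s -> s <= t -> t <= u ->
  flow F u t (flow F t s xi) = flow F u s xi.
Proof.
move=> s0 st tu; have [x solx] := completeF xi s0.
rewrite (flowE s0 st solx) (flowE s0 (le_trans st tu) solx).
exact: (flowE (le_trans s0 st) tu (is_solutionW st solx)).
Qed.

Lemma flow_continuous s t : 0 <= s -> s <= t -> continuous (flow F t s).
Proof.
move=> s0 st xi; have [x solx] := completeF xi s0.
have [k [D [k0 D0 stab]]] := solution_stable t s0 solx.
apply/(@cvgrPdist_lt _ _ _ _ (nbhs_filter (xi : 'rV[R]_d))) => e e0.
near=> xi'; have [y soly] := completeF xi' s0.
rewrite (flowE s0 st solx) (flowE s0 st soly).
have small : sqnorm (xi - xi') * expR (k * (t - s)) < Num.min D (e ^+ 2).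
  by near: xi'; apply: near_sqnorm_lt; rewrite lt_min D0 exprn_gt0.
move: small; rewrite lt_min => /andP[hD he].
have := stab _ _ soly hD t; rewrite st lexx => /(_ isT) Et.
rewrite -(@ltr_pXn2r _ 2)// ?nnegrE ?(ltW e0)//.
exact: le_lt_trans (sqr_norm_le _) (le_lt_trans Et he).
Unshelve. all: by end_near. Qed.

End flow.

(** * Growth of trajectories under the Lyapunov inequality *)

Lemma within_continuousM {R : realType} (A : set R) (f g : R -> R) :
  {within A, continuous f} -> {within A, continuous g} ->
  {within A, continuous (fun t => f t * g t)}.
Proof. by move=> fc gc t; apply: cvgM; [exact: fc|exact: gc]. Qed.

Section lyapunov.
Context {R : realType} {d : nat} (F : R -> 'rV[R]_d -> 'rV[R]_d).
Context (V : 'rV[R]_d -> R).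
Implicit Types (xi : 'rV[R]_d) (x : R -> 'rV[R]_d) (s t a b T : R).
Hypotheses (contF : continuous_field F) (C1V : C1 V).

Let dV x t := 'd V (x t) (F t (x t)).

Lemma is_derive_lyapunov xi x s t : is_solution F s xi x -> s < t ->
  is_derive t 1 (V \o x) (dV x t).
Proof.
move=> [_ _ dx] /dx[/derivable1_diffP difx xF].
have difV : differentiable V (x t) by case: C1V.
apply: DeriveDef; first exact/derivable1_diffP/differentiable_comp.
rewrite deriveE; last exact: differentiable_comp.
by rewrite diff_comp//= /dV -xF deriveE.
Qed.

Lemma diff_grad xi v : 'd V xi v = \sum_(j < d) v ord0 j * grad V xi ord0 j.
Proof.
rewrite {1}[v]row_sum_delta linear_sum/=; apply: eq_bigr => j _.
by rewrite linearZ/= !mxE.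
Qed.

Lemma continuous_field_along xi x s : 0 <= s -> is_solution F s xi x ->
  {within `[s, +oo[, continuous (fun t => F t (x t))}.
Proof.
move=> s0 [_ /subspace_continuousP xc _]; apply/subspace_continuousP => t st.
have t0 : 0 <= t by move: st; rewrite /= in_itv/= andbT; exact: le_trans.
have := (subspace_continuousP _ _).1 contF (t, x t) t0.
apply: (@cvg_comp _ _ _ (fun u => (u, x u))) => P /= nP.
have : (u, x u) @[u --> within `[s, +oo[ (nbhs t)] --> (t, x t).
  have idc : u @[u --> within `[s, +oo[ (nbhs t)] --> t by exact: cvg_within.
  exact: (cvg_pair idc (xc t st)).
move=> /(_ _ nP); apply: filter_app; apply: filterS (withinT _ _) => u /=.
by rewrite in_itv/= andbT => su; apply; exact: le_trans su.
Qed.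

Lemma continuous_lyapunov_along xi x s : is_solution F s xi x ->
  {within `[s, +oo[, continuous (V \o x)}.
Proof.
move=> [_ xc _]; apply: (@within_continuous_comp _ _ _ _ x V) => //.
by move=> y _; apply: differentiable_continuous; case: C1V.
Qed.

Lemma within_continuous_coord (A : set R) (g : R -> 'rV[R]_d) j :
  {within A, continuous g} -> {within A, continuous (fun t => g t ord0 j)}.
Proof.
apply: (@within_continuous_comp _ _ _ _ g (fun y => y ord0 j)) => y _.
exact: coord_continuous.
Qed.

Lemma continuous_dlyapunov_along xi x s : 0 <= s -> is_solution F s xi x ->
  {within `[s, +oo[, continuous (dV x)}.
Proof.
move=> s0 solx; have Fc := continuous_field_along s0 solx; have [_ xc _] := solx.
have -> : dV x = fun t => \sum_(j < d) F t (x t) ord0 j * grad V (x t) ord0 j.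
  by apply/funext => t; rewrite /dV diff_grad.
apply: continuous_big => [|j _ t]; first exact: add_continuous.
have Gc : {within `[s, +oo[, continuous (grad V \o x)}.
  by apply: (@within_continuous_comp _ _ _ _ x) => // y _; exact: C1V.2.
apply: (@within_continuousM _ _ (fun t => F t (x t) ord0 j) (fun t => grad V (x t) ord0 j)).
  exact: within_continuous_coord Fc.
exact: within_continuous_coord Gc.
Qed.

Context (alpha : R -> R) (M1 q : R).
Hypothesis ialpha : locally_integrable_ge0 alpha.
Hypothesis V0 : V 0 = 0.
Hypothesis decay : forall t xi, 0 <= t -> xi <> 0 ->
  'd V xi (F t xi) <= alpha t * V xi + M1 * V xi `^ q.

Notation mu := (@lebesgue_measure R).

Lemma integrable_alpha a b : 0 <= a -> mu.-integrable `[a, b] (EFin \o alpha).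
Proof.
move=> a0; apply: ialpha; first exact: segment_compact.
by move=> t /=; rewrite !in_itv/= andbT => /andP[+ _]; exact: le_trans.
Qed.

(** On an interval where [V] is positive along the trajectory, [ln V] is
continuously differentiable with derivative at most [alpha + M1 V^(q-1)]; so
integrability of [alpha] is all that is needed. *)
Lemma ln_lyapunov_growth xi x a b m : 0 <= a -> a < b ->
  is_solution F 0 xi x ->
  (forall t, a <= t <= b -> 0 < V (x t) /\ M1 * V (x t) `^ (q - 1) <= m) ->
  ln (V (x b)) - ln (V (x a)) <=
    \int[mu]_(t in `[a, b]) alpha t + m * (b - a).
Proof.
move=> a0 ab solx Vpos.
have sub : `[a, b] `<=` `[0, +oo[.
  by move=> t /=; rewrite !in_itv/= andbT => /andP[+ _]; exact: le_trans.
have Vc : {within `[a, b], continuous (V \o x)}.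
  exact: continuous_subspaceW sub (continuous_lyapunov_along solx).
have lnVc : {within `[a, b], continuous (@ln R \o (V \o x))}.
  apply: within_continuous_comp Vc => y; rewrite inE => -[t /= tab <-].
  by apply: continuous_ln; case: (Vpos t) => //; move: tab; rewrite in_itv.
pose f t := dV x t / V (x t).
have fc : {within `[a, b], continuous f}.
  have dVc := continuous_subspaceW sub (continuous_dlyapunov_along (lexx 0) solx).
  apply/subspace_continuousP => t tab.
  have Vt0 : V (x t) != 0.
    by rewrite gt_eqF//; case: (Vpos t) => //; move: tab; rewrite /= in_itv.
  apply: cvgM; first by have /subspace_continuousP := dVc; exact.
  by apply: cvgV => //; have /subspace_continuousP := Vc; exact.
have dlnV t : t \in `]a, b[ -> is_derive t 1 (@ln R \o (V \o x)) (f t).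
  rewrite in_itv/= => /andP[a_t tb].
  have [Vt0 _] : 0 < V (x t) /\ M1 * V (x t) `^ (q - 1) <= m.
    by apply: Vpos; rewrite !ltW.
  have dVt := is_derive_lyapunov solx (le_lt_trans a0 a_t).
  by have := is_derive1_comp (is_derive1_ln Vt0) dVt; rewrite mulrC.
have LRc : derivable_oo_LRcontinuous (@ln R \o (V \o x)) a b.
  have [_ lnVa lnVb] := (continuous_within_itvP _ ab).1 lnVc.
  by split => // t /dlnV dt; exact: (@ex_derive _ _ _ _ _ _ _ dt).
have FTC : (\int[mu]_(t in `[a, b]) (f t)%:E =
    (ln (V (x b)))%:E - (ln (V (x a)))%:E)%E.
  apply: (continuous_FTC2 ab fc LRc) => t /dlnV dt; rewrite derive1E.
  exact: (@derive_val _ _ _ _ _ _ _ dt).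
have -> : ln (V (x b)) - ln (V (x a)) = \int[mu]_(t in `[a, b]) f t.
  by rewrite /Rintegral FTC.
have -> : m * (b - a) = \int[mu]_(t in `[a, b]) m.
  by rewrite Rintegral_cst//= lebesgue_measure_itv/= lte_fin ab.
have iab := integrable_alpha b a0.
have im : mu.-integrable `[a, b] (EFin \o cst m).
  apply: continuous_compact_integrable; first exact: segment_compact.
  by apply: continuous_subspaceT => t; exact: cvg_cst.
rewrite -RintegralD//; apply: le_Rintegral => //.
- by apply: continuous_compact_integrable => //; exact: segment_compact.
- have iD : mu.-integrable `[a, b] ((EFin \o alpha) \+ (EFin \o cst m))%E.
    by apply: integrableD.
  exact: iD.
- move=> t /= tab; have t0 : 0 <= t by move: (sub _ tab); rewrite /= in_itv/= andbT.
  have [Vt0 Vm] : 0 < V (x t) /\ M1 * V (x t) `^ (q - 1) <= m.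
    by apply: Vpos; move: tab; rewrite in_itv.
  have xt0 : x t <> 0 by move=> xt0; move: Vt0; rewrite xt0 V0 ltxx.
  rewrite ler_pdivrMr// mulrDl (le_trans (decay t0 xt0))// lerD2l.
  apply: le_trans (ler_wpM2r (ltW Vt0) Vm).
  by rewrite -mulrA -{3}[V (x t)]powRr1 ?(ltW Vt0)// -powRD ?subrK//
    (gt_eqF Vt0) implybT.
Qed.

Hypothesis V_ge0 : forall xi, 0 <= V xi.

(** From the last time at which [V <= (1 + T)^(1/(1-q))] on, the forcing term
[M1 V^(q-1)] is at most [M1/(1+T)] and contributes at most [M1] to [ln V]. *)
Lemma lyapunov_growth_forced M2 xi x T : q < 1 -> 0 <= M1 -> 0 <= M2 -> 0 <= T ->
  (forall s1 s2, 0 <= s1 -> s1 <= s2 -> \int[mu]_(t in `[s1, s2]) alpha t <= M2) ->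
  is_solution F 0 xi x ->
  V (x T) <= Num.max ((1 + T) `^ (1 - q)^-1) (V xi) * expR (M2 + M1).
Proof.
move=> q1 M10 M20 T0 intalpha solx; have [x0 _ _] := solx.
set c := (1 + T) `^ (1 - q)^-1; set m := Num.max c _.
have T1 : 0 < 1 + T by rewrite ltr_wpDr.
have c0 : 0 < c by rewrite powR_gt0.
have m0 : 0 <= m by rewrite le_max ltW.
have Vc : {within `[0, T], continuous (V \o x)}.
  apply: continuous_subspaceW (continuous_lyapunov_along solx).
  by apply: subset_itvl; rewrite bnd_simp.
have [s [/andP[s0 sT] Vs above]] := last_time_below c T0 Vc.
have Vsm : V (x s) <= m.
  by rewrite le_max; case: Vs => [->|->//]; rewrite x0 lexx orbT.
have [{above}|ltsT] := leP T s.
  move=> Ts; have <- : s = T by apply/eqP; rewrite eq_le sT.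
  rewrite (le_trans Vsm)// ler_peMr// -expR0 ler_expR addr_ge0//.
have {}above t : s <= t <= T -> c <= V (x t) by exact: above.
have Vpos t : s <= t <= T -> 0 < V (x t).
  by move=> /above; exact: lt_le_trans.
have := @ln_lyapunov_growth xi x s T (M1 / (1 + T)) s0 ltsT solx.
have key t : s <= t <= T -> 0 < V (x t) /\ M1 * V (x t) `^ (q - 1) <= M1 / (1 + T).
  move=> stT; split; first exact: Vpos.
  rewrite ler_wpM2l// -[q - 1]opprB powRN lef_pV2 ?posrE ?powR_gt0// ?Vpos//.
  have -> : 1 + T = c `^ (1 - q).
    by rewrite -powRrM mulVf ?powRr1 ?(ltW T1)// gt_eqF// subr_gt0.
  by apply: ge0_ler_powR;
    rewrite ?nnegrE ?subr_ge0 ?(ltW q1) ?(ltW c0) ?above// ltW// Vpos.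
move=> /(_ key) lnV.
have Vs0 : 0 < V (x s) by apply: Vpos; rewrite lexx sT.
have VT0 : 0 < V (x T) by apply: Vpos; rewrite lexx sT.
apply: (@le_trans _ _ (V (x s) * expR (M2 + M1))); last by rewrite ler_wpM2r ?expR_ge0.
rewrite -{1}(lnK VT0) -{1}(lnK Vs0) -expRD ler_expR addrC -lerBlDr.
apply: le_trans lnV _; apply: lerD; first exact: intalpha.
rewrite mulrAC -mulrA ler_piMr// ler_pdivrMr// mul1r.
by lra.
Qed.

(** The estimate from time [0] requires [V] to be positive all the way to [T].
While [V] is positive, [ln V] increases by at most the integral of [|alpha|], so
[V] cannot rise from arbitrarily low levels to a positive [V (x T)]. *)
Lemma lyapunov_growth_unforced xi x T : M1 = 0 -> 0 < T ->
  is_solution F 0 xi x ->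
  V (x T) <= V xi * expR (\int[mu]_(t in `[0, T]) alpha t).
Proof.
move=> M10 T0 solx; have [x0 _ _] := solx.
have [->|VT] := eqVneq (V (x T)) 0; first by rewrite mulr_ge0 ?expR_ge0.
have VT0 : 0 < V (x T) by rewrite lt_neqAle eq_sym VT V_ge0.
set I := \int[mu]_(t in `[0, T]) `|alpha t|.
set c := V (x T) * expR (- I) / 2.
have c0 : 0 < c by rewrite !mulr_gt0 ?expR_gt0 ?invr_gt0.
have iT := integrable_alpha T (lexx 0).
have I0 : 0 <= I by apply: Rintegral_ge0 => t _; exact: normr_ge0.
have cVT : c < V (x T).
  rewrite /c ltr_pdivrMr// ltr_pM2l//.
  by rewrite (@le_lt_trans _ _ 1)// ?ltr1n// -expR0 ler_expR oppr_le0.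
have Vc : {within `[0, T], continuous (V \o x)}.
  apply: continuous_subspaceW (continuous_lyapunov_along solx).
  by apply: subset_itvl; rewrite bnd_simp.
have [s [/andP[s0 sT] Vs above]] := last_time_below c (ltW T0) Vc.
have ltsT : s < T.
  rewrite lt_neqAle sT andbT; apply/eqP => sTe; case: Vs => [|].
    by rewrite sTe => T00; move: T0; rewrite T00 ltxx.
  by rewrite sTe /= leNgt cVT.
have {}above t : s <= t <= T -> c <= V (x t) by exact: above.
have Vpos t : s <= t <= T -> 0 < V (x t).
  by move=> /above; exact: lt_le_trans.
have lnV : ln (V (x T)) - ln (V (x s)) <= \int[mu]_(t in `[s, T]) alpha t.
  have := @ln_lyapunov_growth xi x s T 0 s0 ltsT solx.
  rewrite mul0r addr0; apply => t stT; split; first exact: Vpos.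
  by rewrite M10 mul0r.
have Vs0 : 0 < V (x s) by apply: Vpos; rewrite lexx sT.
have grow J : \int[mu]_(t in `[s, T]) alpha t <= J -> V (x T) <= V (x s) * expR J.
  move=> sJ; rewrite -{1}(lnK VT0) -{1}(lnK Vs0) -expRD ler_expR addrC -lerBlDr.
  exact: le_trans lnV sJ.
case: Vs => [s00|/= Vsc].
  by move: (grow _ (lexx _)); rewrite s00 x0.
have : V (x T) <= V (x s) * expR I.
  apply: grow; apply: le_trans (ler_norm _) _.
  apply: le_trans (le_normr_Rintegral _ (integrable_alpha T s0)) _ => //.
  have iabs u : 0 <= u -> mu.-integrable `[u, T] (EFin \o (fun t => `|alpha t|)).
    by move=> u0; exact: integrable_norm (integrable_alpha T u0).
  apply: fine_le; [exact: integrable_fin_num (iabs _ s0)|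
    exact: integrable_fin_num (iabs _ (lexx 0))|].
  apply: ge0_subset_integral => //=.
  - by case/integrableP: (iabs _ (lexx 0)).
  - by apply: subset_itvr; rewrite bnd_simp.
rewrite leNgt => /negP[]; apply: (@le_lt_trans _ _ (c * expR I)).
  by rewrite ler_wpM2r ?expR_ge0.
rewrite /c mulrAC -(mulrA (V _)) -expRD addNr expR0 mulr1.
by rewrite ltr_pdivrMr// ltr_pMr// ltr1n.
Qed.

End lyapunov.

Section diameter_growth.
Context {R : realType} {d : nat} (F : R -> 'rV[R]_d -> 'rV[R]_d).
Context (V : 'rV[R]_d -> R) (alpha : R -> R) (a1 a2 r M1 q : R).
Hypotheses (contF : continuous_field F) (lipF : locally_lipschitz_field F)
  (completeF : forward_complete F) (ialpha : locally_integrable_ge0 alpha)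
  (C1V : C1 V) (a10 : 0 < a1) (r1 : 1 < r) (M1_ge0 : 0 <= M1)
  (q1 : q < 1).
Hypothesis Vbounds : forall xi : 'rV[R]_d,
  a1 * enorm xi `^ r <= V xi /\ V xi <= a2 * enorm xi `^ r.
Hypothesis decay : forall t xi, 0 <= t -> xi <> 0 ->
  'd V xi (F t xi) <= alpha t * V xi + M1 * V xi `^ q.

Let r0 : 0 < r. Proof. exact: lt_trans r1. Qed.

Lemma lyapunov_ge0 xi : 0 <= V xi.
Proof. by rewrite (le_trans _ (Vbounds xi).1)// mulr_ge0 ?powR_ge0// ltW. Qed.

Lemma lyapunov0 : V 0 = 0.
Proof.
apply/eqP; rewrite eq_le lyapunov_ge0 andbT (le_trans (Vbounds 0).2)//.
by rewrite enorm0 powR0 ?mulr0// gt_eqF.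
Qed.

Lemma norm_le_lyapunov xi B : V xi <= B -> `|xi| <= (B / a1) `^ r^-1.
Proof.
move=> VB; apply: le_trans (norm_le_enorm _) _.
apply: le_powR_inv; rewrite ?sqrtr_ge0// ler_pdivlMr// mulrC.
exact: le_trans (Vbounds xi).1 VB.
Qed.

Lemma diam_flow_growth (K : set 'rV[R]_d) (e B T0 : R) : 0 <= B ->
  (forall T xi, T0 <= T -> K xi -> V (flow F T 0 xi) <= B * T `^ e) ->
  forall T, T0 <= T ->
    diam (flow F T 0 @` K) / 2 <= (B / a1) `^ r^-1 * T `^ (e / r).
Proof.
move=> B0 VB T T0T; apply: diam_le; first by rewrite mulr_ge0 ?powR_ge0.
move=> _ [xi Kxi <-]; apply: le_trans (norm_le_lyapunov (VB T xi T0T Kxi)) _.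
rewrite powRrM -powRM ?powR_ge0// ?divr_ge0 ?(ltW a10)//.
by rewrite mulrAC.
Qed.

(** Under (a) or (b) [V] grows at most like [T^e] with [r / e > m], hence the
diameter at most like [T^(e / r)]. *)
Lemma rho_growth (K : set 'rV[R]_d) (m : R) : compact K ->
    [/\ 0 < M1,
        exists2 M2 : R, 0 < M2 & forall s1 s2 : R, 0 <= s1 -> s1 <= s2 ->
          \int[lebesgue_measure]_(t in `[s1, s2]) alpha t <= M2 &
        m < r * (1 - q)]
    \/
    (M1 = 0 /\
     exists q' t0 : R,
       [/\ 0 < q', 0 < t0, m < r * q' &
           forall t : R, t0 <= t ->
             \int[lebesgue_measure]_(s in `[0, t]) alpha s <= ln t / q']) ->
  exists k B T0 : R, [/\ 0 < k, k * m < 1, 0 <= B &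
    forall T, T0 <= T -> diam (flow F T 0 @` K) / 2 <= B * T `^ k].
Proof.
move=> cK.
have Vc : continuous V by move=> xi; apply: differentiable_continuous; case: C1V.
have [B0 B00 VB0] := compact_bounded_above cK Vc.
have rate e : 0 < e -> m < r * e -> 0 < e^-1 / r /\ e^-1 / r * m < 1.
  move=> e0 me; split; first by rewrite divr_gt0// invr_gt0.
  by rewrite -invfM mulrC ltr_pdivrMr ?mulr_gt0// mul1r mulrC.
case=> [[_ [M2 M20 intalpha] mr]|[M10 [q' [t0 [q'0 t00 mr intalpha]]]]].
  have q10 : 0 < 1 - q by rewrite subr_gt0.
  have [k0 km] := rate _ q10 mr; set e := (1 - q)^-1.
  have e0 : 0 < e by rewrite invr_gt0.
  pose B := (2 `^ e + B0) * expR (M2 + M1).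
  have B_ge0 : 0 <= B by rewrite mulr_ge0 ?expR_ge0// addr_ge0// powR_ge0.
  exists (e / r), ((B / a1) `^ r^-1), 1; split; rewrite ?powR_ge0//.
  apply: diam_flow_growth => // T xi T1 Kxi.
  have T0 : 0 <= T by rewrite (le_trans _ T1).
  have [x solx] := completeF xi (lexx 0).
  rewrite (flowE lipF (lexx 0) T0 solx).
  apply: le_trans (lyapunov_growth_forced contF C1V ialpha lyapunov0 decay
    lyapunov_ge0 q1 M1_ge0 (ltW M20) T0 intalpha solx) _.
  rewrite /B mulrAC ler_wpM2r ?expR_ge0// mulrDl ge_max; apply/andP; split.
    apply: ler_wpDr; first by rewrite mulr_ge0 ?powR_ge0.
    rewrite -powRM//; apply: ge0_ler_powR; rewrite ?nnegrE ?mulr_ge0 ?addr_ge0 ?(ltW e0)//.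
    by lra.
  rewrite (le_trans (VB0 _ Kxi))// ler_wpDl ?mulr_ge0 ?powR_ge0// ler_peMr//.
  by rewrite -[leLHS](powRr0 T) ler_powR// ltW.
have [k0 km] := rate _ q'0 mr.
exists (q'^-1 / r), ((B0 / a1) `^ r^-1), t0; split; rewrite ?powR_ge0//.
apply: diam_flow_growth => // T xi tT Kxi.
have T0 : 0 < T by exact: lt_le_trans tT.
have [x solx] := completeF xi (lexx 0).
rewrite (flowE lipF (lexx 0) (ltW T0) solx).
apply: le_trans (lyapunov_growth_unforced contF C1V ialpha lyapunov0 decay
  lyapunov_ge0 M10 T0 solx) _.
rewrite ler_pM ?expR_ge0 ?lyapunov_ge0 ?VB0//.
by rewrite /powR gt_eqF// ler_expR mulrC intalpha.
Qed.

End diameter_growth.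

(** * Transport costs *)

Section borel.
Context {R : realType} {d : nat}.

Lemma open_borel (U : set 'rV[R]_d) : open U -> measurable (U : set (borel R d)).
Proof. by move=> oU; apply: sub_sigma_algebra. Qed.

Lemma closed_borel (U : set 'rV[R]_d) : closed U -> measurable (U : set (borel R d)).
Proof. by move=> /closed_openC/open_borel/measurableC; rewrite setCK. Qed.

Lemma borel_set1 (x : 'rV[R]_d) : measurable ([set x] : set (borel R d)).
Proof.
by apply: closed_borel; apply: accessible_closed_set1;
  apply: hausdorff_accessible; exact: norm_hausdorff.
Qed.

Lemma continuous_borel (f : 'rV[R]_d -> 'rV[R]_d) : continuous f ->
  measurable_fun setT (f : borel R d -> borel R d).
Proof.
move=> /continuousP fc.
apply: (@measurability _ _ (borel R d) (borel R d) setT f (@open 'rV[R]_d)) => //.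
by move=> _ [U oU <-]; rewrite setTI; apply: open_borel; exact: fc.
Qed.

Lemma measurable_coord j :
  measurable_fun setT (fun x : borel R d => (x : 'rV[R]_d) ord0 j).
Proof.
apply: (measurability _ (RGenOInfty.measurableE R)) => // _ [_ [y ->] <-].
rewrite setTI; apply: open_borel.
have /continuousP := @coord_continuous R 1 d ord0 j; apply.
exact: interval_open.
Qed.

Lemma measurable_edist : measurable_fun setT
  (fun z : borel R d * borel R d => enorm ((z.1 : 'rV[R]_d) - z.2)).
Proof.
rewrite /enorm; apply: (measurableT_comp (f := @Num.sqrt R)).
  by apply: continuous_measurable_fun; exact: sqrt_continuous.
apply: measurable_sum => j; apply: measurable_funX.
have -> : (fun z : borel R d * borel R d => ((z.1 : 'rV[R]_d) - z.2) ord0 j) =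
  (fun z => (z.1 : 'rV[R]_d) ord0 j - (z.2 : 'rV[R]_d) ord0 j).
  by apply/funext => z; rewrite !mxE.
by apply: measurable_funB; apply: (measurableT_comp (measurable_coord j)).
Qed.

Lemma measurable_cost p : measurable_fun setT
  (fun z : borel R d * borel R d => enorm ((z.1 : 'rV[R]_d) - z.2) `^ p).
Proof. exact: measurableT_comp (measurable_powR p) measurable_edist. Qed.

End borel.

(** The pushforward as a bundled probability, with its change of variables. *)
Lemma pushforward_probability d1 d2 (T1 : measurableType d1)
    (T2 : measurableType d2) (R : realType) (P : probability T1 R)
    (f : T1 -> T2) : measurable_fun setT f ->
  exists Q : probability T2 R, (forall A, Q A = pushforward P f A) /\
    forall h : T2 -> \bar R, measurable_fun setT h -> (forall y, 0 <= h y)%E ->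
      (\int[Q]_y h y = \int[P]_x h (f x))%E.
Proof.
move=> mf; pose X : {mfun T1 >-> T2} := HB.pack f (isMeasurableFun.Build _ _ _ _ _ mf).
exists (distribution P X); split=> // h mh h0.
exact: ge0_integral_distribution.
Qed.

Section minkowski_cst.
Local Open Scope ereal_scope.
Context (dT : measure_display) (T : measurableType dT) (R : realType).

Lemma ge0_LnormE (mu : {measure set T -> \bar R}) (f : T -> R) (p : R) :
  (forall x, (0 <= f x)%R) ->
  'N[mu]_p%:E[EFin \o f] = (\int[mu]_x (f x `^ p)%:E) `^ p^-1.
Proof.
move=> f0; rewrite Lnorm.unlock; apply: (f_equal (fun u => u `^ p^-1)).
by apply: eq_integral => x _ /=; rewrite ger0_norm.
Qed.

Lemma minkowski_cst (P : probability T R) (f g : T -> R) (p delta : R) :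
  (1 <= p)%R -> measurable_fun setT f -> measurable_fun setT g ->
  (0 <= delta)%R -> (forall x, 0 <= f x)%R ->
  (forall x, 0 <= g x <= f x + delta)%R ->
  (\int[P]_x (g x `^ p)%:E) `^ p^-1 <=
  (\int[P]_x (f x `^ p)%:E) `^ p^-1 + delta%:E.
Proof.
move=> p1 mf mg delta0 f0 gf; have p0 : (0 < p)%R by exact: lt_le_trans p1.
have pw0 (h : T -> R) : 0 <= \int[P]_x (h x `^ p)%:E.
  by apply: integral_ge0 => x _; rewrite lee_fin powR_ge0.
have := minkowski_EFin P mf (@measurable_cst _ _ _ _ setT delta) p1.
rewrite ge0_LnormE// [in X in _ <= _ + X]ge0_LnormE// ge0_LnormE; last first.
  by move=> x; rewrite addr_ge0.
have -> : \int[P]_x ((cst delta x) `^ p)%:E = (delta `^ p)%:E.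
  transitivity ((delta `^ p)%:E * P setT); last by rewrite probability_setT mule1.
  exact: (integral_cst P measurableT (delta `^ p)%:E).
have -> : (delta `^ p)%:E `^ p^-1 = delta%:E.
  by rewrite poweR_EFin -powRrM mulfV ?gt_eqF// powRr1.
apply: le_trans; apply: gt0_ler_poweR; rewrite ?invr_ge0 ?(ltW p0)//.
- by rewrite in_itv/= leey pw0.
- by rewrite in_itv/= leey pw0.
apply: ge0_le_integral => //.
- by move=> x _; rewrite lee_fin powR_ge0.
- apply/measurable_EFinP; exact: measurableT_comp (measurable_powR p) mg.
- apply/measurable_EFinP; apply: (measurableT_comp (measurable_powR p)).
  by apply: measurable_funD => //; exact: measurable_cst.
- move=> x _; rewrite lee_fin; have /andP[g0 gfx] := gf x.
  by apply: ge0_ler_powR; rewrite ?nnegrE ?addr_ge0// ltW.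
Qed.
End minkowski_cst.

Section transport.
Context {R : realType} {d : nat}.
Implicit Types (mu nu : set (borel R d) -> \bar R) (p e : R).

Definition plan_cost p (pi : probability (borel R d * borel R d)%type R) :=
  (\int[pi]_z (enorm ((z.1 : 'rV[R]_d) - z.2) `^ p)%:E)%E.

(** The [p]-th power of the Wasserstein distance. *)
Definition transport_cost p mu nu : \bar R :=
  ereal_inf [set plan_cost p pi
    | pi in [set pi : probability (borel R d * borel R d)%type R |
             is_coupling pi mu nu]].

Lemma plan_cost_ge0 p (pi : probability (borel R d * borel R d)%type R) :
  (0 <= plan_cost p pi)%E.
Proof. by apply: integral_ge0 => z _; rewrite lee_fin powR_ge0. Qed.

Lemma transport_cost_ge0 p mu nu : (0 <= transport_cost p mu nu)%E.
Proof. by apply: le_ereal_inf_tmp => _ [pi _ <-]; exact: plan_cost_ge0. Qed.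

Lemma wassersteinE p mu nu :
  wasserstein p mu nu = (transport_cost p mu nu `^ p^-1)%E.
Proof. by []. Qed.

Lemma wasserstein_powR p mu nu : 0 < p ->
  (wasserstein p mu nu `^ p)%E = transport_cost p mu nu.
Proof.
by move=> p0; rewrite wassersteinE -poweRrM mulVf ?gt_eqF// poweRe1// transport_cost_ge0.
Qed.

(** Moving the first marginal by a map displacing every point by at most
[delta] changes the [p]-th root of the cost by at most [delta], by Minkowski's
inequality in the space [L^p] of the plan. *)
Lemma plan_cost_map p (pi : probability (borel R d * borel R d)%type R) mu nu
    (f : borel R d -> borel R d) delta :
  1 <= p -> measurable_fun setT f -> is_coupling pi mu nu ->
  (forall z, enorm ((f z : 'rV[R]_d) - z) <= delta) ->
  exists2 pi' : probability (borel R d * borel R d)%type R,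
    is_coupling pi' (pushforward mu f) nu &
    (plan_cost p pi' `^ p^-1 <= plan_cost p pi `^ p^-1 + delta%:E)%E.
Proof.
move=> p1 mf cpl fdelta; have p0 : 0 < p by exact: lt_le_trans p1.
have delta0 : 0 <= delta by rewrite (le_trans _ (fdelta 0)) ?enorm_ge0.
pose g z : borel R d * borel R d := (f z.1, z.2).
have mg : measurable_fun setT g.
  apply/measurable_fun_pairP; split; last exact: measurable_snd.
  exact: measurableT_comp mf _.
have [pi' [pi'E intpi']] := pushforward_probability pi mg.
exists pi'.
  move=> A mA; have mfA : measurable (f @^-1` A).
    by rewrite -[X in measurable X]setTI; exact: mf.
  split; [rewrite -[RHS](cpl _ mfA).1|rewrite -(cpl _ mA).2]; exact: pi'E.
have -> : plan_cost p pi' =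
    (\int[pi]_z (enorm ((f z.1 : 'rV[R]_d) - z.2) `^ p)%:E)%E.
  apply: intpi' => [|z]; last by rewrite lee_fin powR_ge0.
  by apply/measurable_EFinP; exact: measurable_cost.
apply: (@minkowski_cst _ _ _ pi (fun z => enorm ((z.1 : 'rV[R]_d) - z.2))
  (fun z => enorm ((f z.1 : 'rV[R]_d) - z.2))) => //.
- exact: measurable_edist.
- exact: (measurableT_comp measurable_edist mg).
- by move=> z; exact: enorm_ge0.
- move=> z; rewrite enorm_ge0/= [leRHS]addrC.
  by apply: le_trans (enorm_triangle _ (z.1 : 'rV[R]_d) _) _; rewrite lerD2r.
Qed.

End transport.

(** * Measurability of the transport cost of an empirical measure *)

Section empirical.
Context {R : realType} {d N : nat}.
Implicit Types (x y : nat -> borel R d) (A : set (borel R d)).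

Lemma eq_empirical x y : (forall i, (i < N)%N -> x i = y i) ->
  empirical N x = empirical N y.
Proof.
move=> xy; apply/funext => A; rewrite /empirical /mscale /msum/=; congr (_ * _)%E.
by apply: eq_bigr => i _; rewrite xy.
Qed.

Lemma empirical_map x y (f : borel R d -> borel R d) :
  (forall i, (i < N)%N -> f (x i) = y i) ->
  forall A, pushforward (empirical N x) f A = empirical N y A.
Proof.
move=> fxy A; rewrite /pushforward /empirical /mscale /msum/=; congr (_ * _)%E.
apply: eq_bigr => i _; rewrite -fxy// !diracE.
Qed.

(** Moving the sample by a function of the point, instead of splitting the mass
of a plan over repeated points, is possible as soon as equal sample points have
equal targets. *)
Lemma sample_map x y delta : 0 <= delta ->
  (forall i j, (i < N)%N -> (j < N)%N -> x i = x j -> y i = y j) ->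
  (forall i, (i < N)%N -> enorm ((y i : 'rV[R]_d) - x i) <= delta) ->
  exists f : borel R d -> borel R d, [/\ measurable_fun setT f,
    forall i, (i < N)%N -> f (x i) = y i &
    forall z, enorm ((f z : 'rV[R]_d) - z) <= delta].
Proof.
move=> delta0 xyE xy.
pose f (z : borel R d) : borel R d :=
  if [pick i : 'I_N | (x i : 'rV[R]_d) == z] is Some i then y i else z.
have fx i : (i < N)%N -> f (x i) = y i.
  move=> iN; rewrite /f; case: pickP => [j /eqP xj|/(_ (Ordinal iN))]; last by rewrite eqxx.
  exact: xyE xj.
have fout z : (forall i, (i < N)%N -> x i <> z) -> f z = z.
  move=> xz; rewrite /f; case: pickP => [j /eqP xj|//].
  by case: (xz j (ltn_ord j)).
exists f; split => //; last first.
  move=> z; rewrite /f; case: pickP => [j /eqP <-|_]; first exact: xy.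
  by rewrite subrr enorm0.
move=> _ B mB; rewrite setTI.
pose X := \bigcup_(i in [set i | (i < N)%N]) [set x i].
have -> : f @^-1` B =
    (\bigcup_(i in [set i | (i < N)%N /\ B (y i)]) [set x i]) `|` (B `&` ~` X).
  apply/seteqP; split => z /=.
    move=> Bfz; have [[i iN xz]|nX] := pselect (X z).
      left; exists i; last by [].
      by split=> //; rewrite -fx// -xz.
    right; split=> //; rewrite -(fout z)// => i iN xz.
    by apply: nX; exists i.
  case=> [[i [iN By] ->]|[Bz nX]]; first by rewrite fx.
  by rewrite fout// => i iN xz; apply: nX; exists i.
have mbig (D : set nat) : measurable (\bigcup_(i in D) ([set x i] : set (borel R d))).
  by apply: bigcup_measurable => i _; exact: borel_set1.
apply: (@measurableU _ (borel R d)) => //; apply: (@measurableI _ (borel R d)) => //.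
by apply: (@measurableC _ (borel R d)); exact: mbig.
Qed.

(** A plan of cost below [e] is carried along by the map of [sample_map], and by
[plan_cost_map] its cost stays below [e] when the displacement is small. *)
Lemma transport_cost_usc (nu : set (borel R d) -> \bar R) x p e : 1 <= p ->
  (transport_cost p (empirical N x) nu < e%:E)%E ->
  exists2 delta : R, 0 < delta & forall y,
    (forall i j, (i < N)%N -> (j < N)%N -> x i = x j -> y i = y j) ->
    (forall i, (i < N)%N -> `|(y i : 'rV[R]_d) - x i| < delta) ->
    (transport_cost p (empirical N y) nu < e%:E)%E.
Proof.
move=> p1 /ereal_inf_lt[_ [pi cpl <-] pie].
have p0 : 0 < p by exact: lt_le_trans p1.
have e0 : 0 < e by rewrite -lte_fin (le_lt_trans (plan_cost_ge0 _ _) pie).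
have pifin : plan_cost p pi \is a fin_num.
  by rewrite ge0_fin_numE ?plan_cost_ge0// (lt_trans pie)// ltry.
move: pie; rewrite -(fineK pifin) lte_fin; set c := fine _ => ce.
have c0 : 0 <= c by rewrite fine_ge0// plan_cost_ge0.
have gap0 : 0 < e `^ p^-1 - c `^ p^-1.
  by rewrite subr_gt0 gt0_ltr_powR ?invr_gt0 ?nnegrE ?(ltW e0).
set gap := e `^ p^-1 - c `^ p^-1 in gap0.
pose k := Num.sqrt d%:R + 1 : R.
have k0 : 0 < k by rewrite ltr_wpDl ?sqrtr_ge0.
exists (gap / 2 / k); first by rewrite !divr_gt0.
move=> y xyE xy.
have [f [mf fx fdelta]] : exists f : borel R d -> borel R d, [/\ measurable_fun setT f,
    forall i, (i < N)%N -> f (x i) = y i &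
    forall z, enorm ((f z : 'rV[R]_d) - z) <= gap / 2].
  apply: sample_map => //; first by rewrite divr_ge0// ltW.
  move=> i iN; rewrite (le_trans (enorm_le _))//.
  have := xy i iN; rewrite ltr_pdivlMr// => /ltW; apply: le_trans.
  by rewrite mulrC ler_wpM2l// lerDl.
have [pi' cpl' pi'cost] := plan_cost_map p1 mf cpl fdelta.
apply: (@le_lt_trans _ _ (plan_cost p pi')).
  apply: ereal_inf_lbound; exists pi' => //= A mA; have [h1 h2] := cpl' A mA.
  by split=> //; rewrite h1; exact: empirical_map.
have := pi'cost; rewrite -(fineK pifin) -/c poweR_EFin -EFinD => pi'cost'.
have pi'fin : plan_cost p pi' \is a fin_num.
  rewrite ge0_fin_numE ?plan_cost_ge0//; apply: (@lty_poweRy _ _ p^-1).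
    by rewrite invr_eq0 gt_eqF.
  exact: le_lt_trans pi'cost' (ltry _).
move: pi'cost'; rewrite -(fineK pi'fin) poweR_EFin lee_fin lte_fin => h.
have c'0 : 0 <= fine (plan_cost p pi') by rewrite fine_ge0// plan_cost_ge0.
rewrite ltNge; apply/negP => ec'.
have : e `^ p^-1 <= fine (plan_cost p pi') `^ p^-1.
  by apply: ge0_ler_powR; rewrite ?invr_ge0 ?nnegrE ?(ltW p0) ?(ltW e0).
move=> /le_trans/(_ h); rewrite /gap in gap0 *; lra.
Qed.

End empirical.

Section rational_points.
Context {R : realType} {d : nat}.

Definition rat_row (c : 'rV[rat]_d) : 'rV[R]_d := map_mx ratr c.

Lemma rat_row_dense (x : 'rV[R]_d) (e : R) : 0 < e ->
  exists c, `|x - rat_row c| < e.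
Proof.
move=> e0.
have h j : {q : rat | `|x ord0 j - ratr q| < e}.
  apply: cid; have /rat_in_itvoo[q] : x ord0 j - e < x ord0 j + e by lra.
  by rewrite in_itv/= => /andP[h1 h2]; exists q; rewrite ltr_distlC; lra.
exists (\row_j sval (h j)); rewrite /Num.norm/= mx_normrE.
apply/bigmax_ltP; split=> // -[i j] _ /=; rewrite (ord1 i) !mxE.
exact: (svalP (h j)).
Qed.

End rational_points.

Section measurable_transport.
Context {R : realType} {d N : nat} {dO : measure_display}
  {Omega : measurableType dO} (X : nat -> Omega -> borel R d).
Hypothesis mX : forall i, (i < N)%N -> measurable_fun setT (X i).

Let pattern w : {set 'I_N * 'I_N} :=
  [set ij : 'I_N * 'I_N | (X ij.1 w : 'rV[R]_d) == X ij.2 w]%SET.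

Lemma measurable_coincidence i j : (i < N)%N -> (j < N)%N ->
  measurable [set w | X i w = X j w].
Proof.
move=> iN jN.
have mXX : measurable_fun setT (fun w => (X i w, X j w)).
  by apply/measurable_fun_pairP; split; exact: mX.
have md := measurableT_comp measurable_edist mXX.
have := md measurableT [set 0] (measurable_set1 0); rewrite setTI.
rewrite (_ : _ @^-1` _ = [set w | X i w = X j w])//.
apply/seteqP; split=> w /=; last by move=> ->; rewrite subrr enorm0.
move=> /(congr1 (fun u => u ^+ 2)); rewrite expr0n sqr_enorm => /eqP; rewrite eq_le.
by move=> /andP[/sqnorm_eq0/eqP + _]; rewrite subr_eq0 => /eqP.
Qed.

Lemma measurable_pattern E : measurable [set w | pattern w = E].
Proof.
have -> : [set w | pattern w = E] = \bigcap_(ij in [set: 'I_N * 'I_N])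
    (if ij \in E then [set w | X ij.1 w = X ij.2 w]
     else ~` [set w | X ij.1 w = X ij.2 w]).
  apply/seteqP; split=> w /=.
    move=> wE [i j] _ /=; rewrite -wE inE /=.
    by case: ifPn => /eqP.
  move=> h; apply/setP => -[i j]; rewrite inE/=.
  by have /= := h (i, j) I; case: ifPn => /= _ /eqP // /negPf.
apply: fin_bigcap_measurable => // -[i j] _ /=.
case: ifP => _; last apply: measurableC; exact: measurable_coincidence.
Qed.

(** On the event that the coincidences between sample points are a given set
[E], the event of a cost below [e] is relatively open in the sample, hence a
countable union of products of rational balls. *)
Lemma measurable_transport_cost_lt (nu : set (borel R d) -> \bar R) p e : 1 <= p ->
  measurable [set w | (transport_cost p (empirical N (fun i => X i w)) nu < e%:E)%E].
Proof.
move=> p1; set A := [set w | _].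
pose idx : Type := ({set 'I_N * 'I_N} * 'M[rat]_(N, d) * nat)%type.
pose B (k : idx) := [set w | pattern w = k.1.1] `&`
  \bigcap_(i in [set: 'I_N])
    (X i @^-1` (ball (rat_row (row i k.1.2)) (k.2.+1%:R^-1 : R))).
have mB k : measurable (B k).
  apply: measurableI; first exact: measurable_pattern.
  apply: fin_bigcap_measurable => // i _.
  rewrite -[X in measurable X]setTI; apply: mX => //.
  by apply: open_borel; apply: ball_open; rewrite invr_gt0.
have -> : A = \bigcup_(k in [set: idx]) (if `[< B k `<=` A >] then B k else set0).
  apply/seteqP; split=> w; last first.
    by move=> [k _]; case: ifPn => // /asboolP; exact.
  move=> Aw; have [delta delta0 usc] := transport_cost_usc p1 Aw.
  have d20 : 0 < delta / 2 by rewrite divr_gt0.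
  have [n nd] : exists n, n.+1%:R^-1 < delta / 2.
    have /filter_ex[n hn] := near_infty_natSinv_lt (PosNum d20); by exists n.
  have n0 : 0 < n.+1%:R^-1 :> R by rewrite invr_gt0.
  have c i := cid (rat_row_dense (X i w : 'rV[R]_d) n0).
  pose k : idx := (pattern w, \matrix_(i < N) sval (c i), n).
  have Bkw : B k w.
    split=> // i _; rewrite /= rowK -ball_normE/= distrC.
    exact: (svalP (c i)).
  exists k => //; suff BA : B k `<=` A by rewrite asboolT.
  move=> v [/= vw Bv]; apply: usc.
    move=> i j iN jN wij.
    have : (Ordinal iN, Ordinal jN) \in pattern w by rewrite inE/=; apply/eqP.
    by rewrite -vw inE/= => /eqP.
  move=> i iN; have := Bv (Ordinal iN) I; rewrite /= rowK -ball_normE/=.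
  set q := rat_row _ => vq.
  have wq : `|X i w - q| < n.+1%:R^-1 := svalP (c (Ordinal iN)).
  rewrite (le_lt_trans (ler_distD q _ _))// (splitr delta) ltrD//.
    by rewrite distrC (lt_trans vq).
  by rewrite distrC (lt_trans wq).
apply: countable_bigcupT_measurable; first exact: countableP.
by move=> k; case: ifP.
Qed.

Lemma measurable_transport_cost_le (nu : set (borel R d) -> \bar R) p e : 1 <= p ->
  measurable [set w | (transport_cost p (empirical N (fun i => X i w)) nu <= e%:E)%E].
Proof.
move=> p1; pose c w := transport_cost p (empirical N (fun i => X i w)) nu.
rewrite -[X in measurable X]/[set w | (c w <= e%:E)%E].
have -> : [set w | (c w <= e%:E)%E] =
    \bigcap_n [set w | (c w < (e + n.+1%:R^-1)%:E)%E].
  apply/seteqP; split=> w /=.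
    by move=> cw n _ /=; rewrite (le_lt_trans cw)// lte_fin ltrDl invr_gt0.
  move=> h; apply/lee_addgt0Pr => r r0.
  have /filter_ex[n hn] := near_infty_natSinv_lt (PosNum r0).
  by rewrite (le_trans (ltW (h n I)))// -EFinD lee_fin lerD2l ltW.
by apply: bigcapT_measurable => n; exact: measurable_transport_cost_lt.
Qed.

End measurable_transport.

(** * The support of a probability measure *)

Section support.
Context {R : realType} {d : nat} (mu : probability (borel R d) R).

Lemma closed_support : closed (measure_support mu).
Proof.
move=> x clx U oU Ux; have [y [ys Uy]] := clx U (open_nbhs_nbhs (conj oU Ux)).
exact: ys U oU Uy.
Qed.

Lemma support_sub (K : set 'rV[R]_d) : closed K -> mu K = 1%E ->
  measure_support mu `<=` K.
Proof.
move=> cK muK x xs; apply: contrapT => nKx.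
have := xs (~` K) (closed_openC cK) nKx.
by rewrite probability_setC ?muK ?subee ?ltxx//; exact: closed_borel.
Qed.

(** The complement of the support is covered by the null balls with rational
centre and radius, of which there are countably many. *)
Lemma support_full : mu (measure_support mu) = 1%E.
Proof.
pose S : set (borel R d) := measure_support mu.
have mS : measurable S.
  by apply: closed_borel; exact: closed_support.
pose idx : Type := ('rV[rat]_d * nat)%type.
pose B (k : idx) : set (borel R d) := ball (rat_row k.1) (k.2.+1%:R^-1 : R).
have mB k : measurable (B k) by apply: open_borel; apply: ball_open; rewrite invr_gt0.
pose C (m : nat) : set (borel R d) :=
  if unpickle m is Some k then if mu (B k) == 0%E then B k else set0 else set0.
have mC m : measurable (C m).
  by rewrite /C; case: unpickle => // k; case: ifP.
have nC m : mu.-negligible (C m).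
  rewrite /C; case: unpickle => [k|]; last exact: negligible_set0.
  case: ifP => [/eqP k0|_]; last exact: negligible_set0.
  by apply/negligibleP.
have sC : ~` S `<=` \bigcup_m C m.
  move=> x nx.
  have [U [oU Ux muU]] : exists U : set 'rV[R]_d, [/\ open U, U x & ~ (0 < mu U)%E].
    apply: contrapT => h; apply: nx => U oU Ux; apply: contrapT => muU.
    by apply: h; exists U.
  have /nbhs_ballP[e /= e0 eU] := open_nbhs_nbhs (conj oU Ux).
  have e20 : 0 < e / 2 by rewrite divr_gt0.
  have [n ne] : exists n, n.+1%:R^-1 < e / 2.
    have /filter_ex[n hn] := near_infty_natSinv_lt (PosNum e20); by exists n.
  have n0 : 0 < n.+1%:R^-1 :> R by rewrite invr_gt0.
  have [c xc] := rat_row_dense x n0.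
  exists (pickle ((c, n) : idx)) => //; rewrite /C pickleK.
  have BU : B (c, n) `<=` U.
    move=> y; rewrite /B/= -ball_normE/= => cy; apply: eU; rewrite -ball_normE/=.
    rewrite (le_lt_trans (ler_distD (rat_row c) _ _))// (splitr e) ltrD//.
      exact: lt_trans ne.
    exact: lt_trans ne.
  have -> : mu (B (c, n)) == 0%E.
    rewrite eq_le measure_ge0 andbT leNgt; apply/negP => B0; apply: muU.
    apply: lt_le_trans B0 (le_measure _ _ _ BU); rewrite inE//.
    exact: open_borel.
  by rewrite /B/= -ball_normE/= distrC.
have nS : mu (~` S) = 0%E.
  apply: measure_negligible; first exact: measurableC.
  exact: negligibleS sC (negligible_bigcup nC).
rewrite -[measure_support mu]/S -(setCK S) probability_setC ?nS ?sube0//.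
exact: measurableC.
Qed.
End support.

(** * The ambiguity radius *)

Section hfun.
Context {R : realType}.
Implicit Types (x y u e : R).

Let ln_pos x : 0 < x -> 0 < ln (2 + x^-1).
Proof. by move=> x0; rewrite ln_gt0// ltr_pwDr ?invr_gt0// ler1n. Qed.

Lemma hfun_gt0 x : 0 < x -> 0 < hfun x.
Proof. by move=> x0; rewrite /hfun divr_gt0// exprn_gt0// ln_pos. Qed.

Lemma le_hfun x y : 0 < x -> x <= y -> hfun x <= hfun y.
Proof.
move=> x0 xy; have y0 : 0 < y by exact: lt_le_trans xy.
have le_ln : ln (2 + y^-1) <= ln (2 + x^-1).
  by rewrite ler_ln ?posrE ?addr_gt0 ?invr_gt0// lerD2l lef_pV2.
rewrite /hfun ler_pM ?sqr_ge0 ?invr_ge0 ?sqr_ge0//.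
  by rewrite lerXn2r ?nnegrE ?(ltW x0) ?(ltW y0).
rewrite lef_pV2 ?posrE ?exprn_gt0 ?ln_pos//.
by rewrite lerXn2r ?nnegrE ?(ltW (ln_pos x0)) ?(ltW (ln_pos y0)).
Qed.

Lemma ln_le_powR x e : 0 < x -> 0 < e -> ln x <= x `^ e / e.
Proof.
move=> x0 e0; rewrite ler_pdivlMr// mulrC -ln_powR.
exact/ltW/ln_sublinear/powR_gt0.
Qed.

(** Since [ln] grows more slowly than any power, [hfun] dominates near [0], up to
a constant, every power with exponent larger than [2]. *)
Lemma powR_le_hfun e : 0 < e -> exists2 D, 0 < D & forall x, 0 < x <= 1 ->
  x `^ (2 * (1 + e)) <= D * hfun x.
Proof.
move=> e0; pose D := (3 `^ e / e) ^+ 2.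
have e3 : 0 < 3 `^ e / e by rewrite divr_gt0// powR_gt0.
exists D; first by rewrite exprn_gt0.
move=> x /andP[x0 x1].
have lnx : ln (2 + x^-1) <= 3 `^ e / e * x `^ (- e).
  apply: (@le_trans _ _ (ln (3 * x^-1))).
    rewrite ler_ln ?posrE ?addr_gt0 ?mulr_gt0 ?invr_gt0//.
    have : 1 <= x^-1 by rewrite invf_ge1.
    lra.
  apply: le_trans (ln_le_powR _ e0) _; first by rewrite mulr_gt0 ?invr_gt0.
  rewrite powRM ?invr_ge0 ?(ltW x0)// mulrAC ler_wpM2l ?(ltW e3)//.
  by rewrite -powR_inv1 ?(ltW x0)// -powRrM mulN1r.
have -> : x `^ (2 * (1 + e)) = x ^+ 2 * (x `^ e) ^+ 2.
  by rewrite mulrDr mulr1 powRD ?(gt_eqF x0) ?implybT// [2 * e]mulrC powRrM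
    -!powR_mulrn ?powR_ge0 ?(ltW x0).
rewrite /hfun [leRHS]mulrCA ler_wpM2l ?sqr_ge0// ler_pdivlMr ?exprn_gt0 ?ln_pos//.
rewrite -exprMn lerXn2r ?nnegrE ?(ltW e3) ?(mulr_ge0 (powR_ge0 _ _) (ltW (ln_pos x0)))//.
apply: le_trans (ler_wpM2l (powR_ge0 _ _) lnx) _.
by rewrite mulrCA -powRD ?subrr ?powRr0 ?mulr1// (gt_eqF x0) implybT.
Qed.

Lemma hfun_surj y : 0 < y -> exists2 x, 0 < x & hfun x = y.
Proof.
move=> y0.
(* ln (2 + x^-1) is at least ln 2, and at most ln 3 once 1 <= x; a and b are
   where these bounds give hfun a <= y and y <= hfun b *)
have ln2 : 0 < ln 2 :> R by rewrite ln_gt0// ltr1n.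
have ln23 : ln 2 <= ln 3 :> R by rewrite ler_ln ?posrE// ler_nat.
pose a := Num.sqrt y * ln 2; pose b := Num.max 1 (Num.sqrt y * ln 3).
have a0 : 0 < a by rewrite mulr_gt0 ?sqrtr_gt0.
have b1 : 1 <= b by rewrite le_max lexx.
have b0 : 0 < b by exact: lt_le_trans b1.
have ab : a <= b by rewrite le_max ler_wpM2l ?sqrtr_ge0 ?orbT.
have hc : {within `[a, b], continuous (@hfun R)}.
  apply: continuous_in_subspaceT => x; rewrite inE/= in_itv/= => /andP[ax _].
  have x0 : 0 < x by exact: lt_le_trans ax.
  have cx : z @[z --> x] --> x by exact: cvg_id.
  have c1 : (2 + z^-1) @[z --> x] --> 2 + x^-1.
    by apply: cvgD; [exact: cvg_cst|apply: cvgV; rewrite ?gt_eqF].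
  have c2 : ln (2 + z^-1) @[z --> x] --> ln (2 + x^-1).
    by apply: (cvg_comp _ _ c1); apply: continuous_ln; rewrite addr_gt0// invr_gt0.
  have l0 : ln (2 + x^-1) * ln (2 + x^-1) != 0 by rewrite mulf_neq0// gt_eqF// ln_pos.
  exact: (cvgM (cvgM cx cx) (cvgV l0 (cvgM c2 c2))).
have ha : hfun a <= y.
  rewrite /hfun ler_pdivrMr ?exprn_gt0 ?ln_pos// /a exprMn sqr_sqrtr ?(ltW y0)//.
  rewrite ler_wpM2l ?(ltW y0)// lerXn2r ?nnegrE ?(ltW ln2) ?(ltW (ln_pos a0))//.
  by rewrite ler_ln ?posrE ?addr_gt0 ?invr_gt0// lerDl invr_ge0 ltW.
have hb : y <= hfun b.
  rewrite /hfun ler_pdivlMr ?exprn_gt0 ?ln_pos//.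
  apply: (@le_trans _ _ ((Num.sqrt y * ln 3) ^+ 2)).
    rewrite exprMn sqr_sqrtr ?(ltW y0)// ler_wpM2l ?(ltW y0)//.
    rewrite lerXn2r ?nnegrE ?(ltW (ln_pos b0)) ?(le_trans (ltW ln2))//.
    rewrite ler_ln ?posrE ?addr_gt0 ?invr_gt0//.
    have : b^-1 <= 1 by rewrite invf_le1.
    lra.
  rewrite lerXn2r ?nnegrE ?(ltW b0)//.
    by rewrite mulr_ge0 ?sqrtr_ge0// (le_trans (ltW ln2)).
  by rewrite le_max lexx orbT.
have [|x] := IVT (v := y) ab hc; first by rewrite ge_min ha/= le_max hb orbT.
by rewrite in_itv/= => /andP[ax _] hx; exists x => //; exact: lt_le_trans ax.
Qed.

Lemma hinvK y : 0 < y -> 0 < hinv y /\ hfun (hinv y) = y.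
Proof.
move=> y0.
have surj : set_surj [set x : R | 0 < x] [set y : R | 0 < y] (@hfun R).
  by move=> z /= /hfun_surj[x x0 <-]; exists x.
split; last by rewrite /hinv (surjpK _ surj)// inE.
by apply: (surjpinv_image_sub (dflt := fun=> 0) surj); exists y.
Qed.

(** No positive number has a nonpositive image under [hfun], so the partial
inverse takes its default value. *)
Lemma hinv_le0 y : y <= 0 -> hinv y = 0.
Proof.
move=> y0; rewrite /hinv /pinv_ splitV /=.
set A := [set x : R | 0 < x].
have -> : 'oinv_([fun @hfun R in A]) y = None; last by [].
rewrite [LHS](oinv_surj ((fun _ => id) : set_surj A (@hfun R @` A) (@hfun R))).
case: pselect => // -[x /= x0 hx].
by have := hfun_gt0 x0; rewrite hx ltNge y0.
Qed.

End hfun.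

Section radius.
Context {R : realType} {d : nat} (p C c beta : R).
Hypotheses (d0 : (0 < d)%N) (p1 : 1 <= p) (C0 : 0 < C) (c0 : 0 < c)
  (beta0 : 0 < beta).
Implicit Types (N : nat) (e rho : R).

Let p0 : 0 < p. Proof. exact: lt_le_trans p1. Qed.

Lemma radius_ge0 N rho : 0 <= rho -> 0 <= ambiguity_radius d p C c N beta rho.
Proof.
move=> rho0; rewrite /ambiguity_radius; case: ifP => _; last case: ifP => _;
  by rewrite mulr_ge0 ?powR_ge0// divr_ge0// powR_ge0.
Qed.

Lemma exp_le_beta L N g : L = ln (C * beta^-1) -> L <= c * N%:R * g ->
  C * expR (- (c * N%:R * g)) <= beta.
Proof.
move=> LE Lg; have CB : 0 < C * beta^-1 by rewrite mulr_gt0 ?invr_gt0.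
apply: (@le_trans _ _ (C * expR (- L))).
  by rewrite ler_wpM2l ?(ltW C0)// ler_expR lerN2.
by rewrite LE expRN lnK// invfM invrK mulrA mulfV ?mul1r// gt_eqF.
Qed.

(** The radius is defined so that its [p]-th power solves [chi = beta] for the
unknown [eps]; [chi] decreases in [eps] and increases in the half-diameter.
When [C <= beta] the bound [chi <= C] suffices. *)
Lemma chi_le N e rho rho' : (0 < N)%N -> 0 < rho -> rho <= rho' -> 0 < e ->
  ambiguity_radius d p C c N beta rho' `^ p <= e ->
  chi d p C c N e rho <= beta.
Proof.
move=> N0 rho0 rr' e0 rade; have r'0 : 0 < rho' by exact: lt_le_trans rr'.
have cN0 : 0 < c * N%:R by rewrite mulr_gt0 ?ltr0n.
set L := ln (C * beta^-1) in rade *.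
have powm (a : R) : 0 <= a -> rho `^ a <= rho' `^ a.
  by move=> a0; apply: ge0_ler_powR; rewrite ?nnegrE ?(ltW rho0) ?(ltW r'0).
have [L0|L0] := leP L 0.
  have small g : 0 <= g -> C * expR (- (c * N%:R * g)) <= beta.
    move=> g0; apply: (@exp_le_beta L) => //.
    by rewrite (le_trans L0)// mulr_ge0// ltW.
  rewrite /chi; case: ifP => _; [|case: ifP => _]; apply: small.
  - by rewrite divr_ge0 ?sqr_ge0 ?powR_ge0.
  - by rewrite divr_ge0 ?sqr_ge0// mulr_ge0 ?powR_ge0 ?sqr_ge0.
  - by rewrite divr_ge0 ?powR_ge0// exprn_ge0// ltW.
have Lc0 : 0 < L / c by rewrite divr_gt0.
have N0' : 0 < N%:R :> R by rewrite ltr0n.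
move: rade; rewrite /ambiguity_radius /chi -/L.
(* for p > d/2 (m = 2p) and p < d/2 (m = d), the m-th power isolates L / c *)
have outer m : 0 < m -> ((L / c) `^ m^-1 * (rho' / N%:R `^ m^-1)) `^ p <= e ->
    L <= c * N%:R * (e `^ (m / p) / rho `^ m).
  move=> m0 rade; have mN0 : m != 0 by rewrite gt_eqF.
  have base0 : 0 <= (L / c) `^ m^-1 * (rho' / N%:R `^ m^-1).
    by rewrite mulr_ge0 ?divr_ge0 ?powR_ge0 ?(ltW r'0).
  have h : (L / c) * (rho' `^ m / N%:R) <= e `^ (m / p).
    rewrite [m / p]mulrC powRrM.
    have <- : ((L / c) `^ m^-1 * (rho' / N%:R `^ m^-1)) `^ m = L / c * (rho' `^ m / N%:R).
      rewrite powRM ?powR_ge0 ?divr_ge0 ?(ltW r'0) ?powR_ge0// powR_invK ?(ltW Lc0)//.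
      by rewrite powR_div ?powR_ge0 ?(ltW r'0)// powR_invK// ltW.
    apply: ge0_ler_powR; rewrite ?nnegrE ?powR_ge0 ?(ltW m0)//.
    exact: le_powR_inv.
  rewrite mulrA ler_pdivlMr ?powR_gt0//.
  apply: le_trans (ler_wpM2l (ltW L0) (powm m (ltW m0))) _.
  apply: le_trans (ler_wpM2l (ltW cN0) h).
  rewrite le_eqVlt; apply/orP; left; apply/eqP; field.
  by rewrite !gt_eqF.
case: ifP => [pd|_]; [|case: ifP => [_|_]] => rade; apply: (@exp_le_beta L) => //.
- have := outer (2 * p); rewrite mulr_gt0// => /(_ isT rade).
  by rewrite mulfK ?gt_eqF// powR_mulrn ?(ltW e0).
- set u := hinv _ in rade.
  have [u0 hu] : 0 < u /\ hfun u = L / (c * N%:R) by apply: hinvK; rewrite divr_gt0.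
  have ux : u <= e / rho `^ p.
    rewrite ler_pdivlMr ?powR_gt0//.
    apply: le_trans (ler_wpM2l (ltW u0) (powm p (ltW p0))) _.
    move: rade; rewrite powRM ?powR_ge0 ?(ltW r'0)//.
    by rewrite -powRrM mulVf ?gt_eqF// powRr1// ltW.
  have := le_hfun u0 ux; rewrite hu ler_pdivrMr// mulrC => /le_trans; apply.
  rewrite ler_pM2l// /hfun invf_div expr_div_n -mulrA.
  have -> : rho `^ (2 * p) = (rho `^ p) ^+ 2.
    by rewrite [2 * p]mulrC powRrM powR_mulrn ?powR_ge0.
  by rewrite [in leRHS](invfM (_ ^+ 2)).
- have := outer d%:R; rewrite ltr0n => /(_ d0 rade).
  by rewrite powR_mulrn// ltW.
Qed.

Lemma cvg_powRN0 (f : R -> R) (B k : R) : 0 < k ->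
  (\forall T \near +oo, 0 <= f T <= B * T `^ (- k)) -> f T @[T --> +oo] --> 0.
Proof.
move=> k0 fB; apply/cvgrPdist_lt => e e0.
pose T1 := (`|B| / e) `^ k^-1.
near=> T.
have T0 : 0 < T by near: T; apply: nbhs_pinfty_gt; exact: num_real.
have /andP[f0 fT] : 0 <= f T <= B * T `^ (- k) by near: T.
rewrite sub0r normrN ger0_norm// (le_lt_trans fT)//.
apply: (@le_lt_trans _ _ (`|B| * T `^ (- k))).
  by rewrite ler_wpM2r ?powR_ge0// ler_norm.
rewrite powRN ltr_pdivrMr ?powR_gt0// mulrC -ltr_pdivrMr//.
rewrite ltNge; apply/negP => /(le_powR_inv (ltW T0) k0).
rewrite leNgt => /negP; apply; near: T; apply: nbhs_pinfty_gt; exact: num_real.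
Unshelve. all: by end_near. Qed.

(** From [T <= Delta * N] the radius is at most a constant times
[T^(k - 1/m)], with [m] either [2p] or [d].  In the regime [p = d/2] the bound
[powR_le_hfun] replaces [2p] by [2p(1 + e)], and the strict inequality on [k]
leaves room for that. *)
Lemma radius_cvg (Nbar : R -> nat) (rho : R -> R) (Delta k B T0 : R) :
  0 < Delta -> (forall T, 0 <= T -> T <= Delta * (Nbar T)%:R) ->
  0 < k -> k * Num.max (2 * p) d%:R < 1 -> 0 <= B ->
  (forall T, T0 <= T -> 0 <= rho T <= B * T `^ k) ->
  ambiguity_radius d p C c (Nbar T) beta (rho T) @[T --> +oo] --> (0 : R).
Proof.
move=> Delta0 NT k0 km B0 rhoB; set L := ln (C * beta^-1).
have NR T : 0 < T -> 0 < (Nbar T)%:R :> R.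
  by move=> T0'; rewrite -(pmulr_rgt0 _ Delta0) (lt_le_trans T0')// NT// ltW.
have kp : k * (2 * p) < 1.
  by apply: le_lt_trans km; rewrite ler_pM2l// le_max lexx.
have kd : k * d%:R < 1.
  by apply: le_lt_trans km; rewrite ler_pM2l// le_max lexx orbT.
have outer m : 0 < m -> k * m < 1 ->
    (L / c) `^ m^-1 * (rho T / (Nbar T)%:R `^ m^-1) @[T --> +oo] --> 0.
  move=> m0 km1.
  apply: (@cvg_powRN0 _ ((L / c) `^ m^-1 * (B * Delta `^ m^-1)) (m^-1 - k)).
    by rewrite subr_gt0 -(ltr_pM2r m0) mulVf ?gt_eqF.
  near=> T.
  have T_gt0 : 0 < T by near: T; apply: nbhs_pinfty_gt; exact: num_real.
  have T0T : T0 <= T by near: T; apply: nbhs_pinfty_ge; exact: num_real.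
  have /andP[r0 rB] := rhoB T T0T.
  rewrite mulr_ge0 ?divr_ge0 ?powR_ge0//= -mulrA ler_wpM2l ?powR_ge0//.
  rewrite ler_pdivrMr ?powR_gt0 ?NR// (le_trans rB)// -!mulrA ler_wpM2l//.
  apply: (@le_trans _ _ (T `^ (- (m^-1 - k)) * T `^ m^-1)).
    by rewrite -powRD ?opprB ?subrK// (gt_eqF T_gt0) implybT.
  rewrite mulrCA ler_wpM2l ?powR_ge0// -powRM ?(ltW Delta0)//.
  apply: ge0_ler_powR; rewrite ?nnegrE ?invr_ge0 ?(ltW m0) ?(ltW T_gt0)//.
    by rewrite mulr_ge0// ltW.
  by rewrite NT// ltW.
rewrite /ambiguity_radius; case: (boolP (d%:R / 2 < p)) => _;
  last case: (boolP (p == d%:R / 2)) => _.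
- by apply: outer => //; rewrite mulr_gt0.
- have [L0|L0] := leP L 0.
    apply: (@cvg_trans _ (cst 0 T @[T --> +oo])); last exact: cvg_cst.
    apply: near_eq_cvg; near=> T => /=.
    have T_gt0 : 0 < T by near: T; apply: nbhs_pinfty_gt; exact: num_real.
    rewrite hinv_le0 ?powR0 ?mul0r// ?invr_eq0 ?gt_eqF//.
    by rewrite pmulr_lle0// invr_gt0 mulr_gt0// NR.
  (* e is chosen so that k * 2p * (1 + e) is the midpoint of k * 2p and 1 *)
  pose e := ((k * (2 * p))^-1 - 1) / 2.
  have kp0 : 0 < k * (2 * p) by rewrite !mulr_gt0.
  have e0 : 0 < e by rewrite divr_gt0// subr_gt0 invf_gt1.
  have ke : k * (2 * p) * (1 + e) < 1.
    have -> : k * (2 * p) * (1 + e) = (1 + k * (2 * p)) / 2.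
      by rewrite /e; field; rewrite !gt_eqF.
    by lra.
  have [D D0 hD] := powR_le_hfun e0.
  pose s := 2 * (1 + e).
  have s0 : 0 < s by rewrite mulr_gt0// addr_gt0.
  pose A := D * (L * Delta / c).
  have A0 : 0 < A by rewrite !mulr_gt0 ?invr_gt0.
  apply: (@cvg_powRN0 _ (A `^ (s^-1 / p) * B) (s^-1 / p - k)).
    rewrite subr_gt0 ltr_pdivlMr// -(ltr_pM2r s0) mulVf ?(gt_eqF s0)//.
    by rewrite (_ : k * p * s = k * (2 * p) * (1 + e))// /s; ring.
  near=> T.
  have T_gt0 : 0 < T by near: T; apply: nbhs_pinfty_gt; exact: num_real.
  have T0T : T0 <= T by near: T; apply: nbhs_pinfty_ge; exact: num_real.
  have /andP[r0 rB] := rhoB T T0T.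
  rewrite mulr_ge0 ?powR_ge0//=.
  set y := L / (c * _).
  have y0 : 0 < y by rewrite divr_gt0// mulr_gt0// NR.
  have yT : y <= L * Delta / c / T.
    rewrite ler_pdivlMr// /y mulrAC ler_pdivrMr ?mulr_gt0 ?NR//.
    have -> : L * Delta / c * (c * (Nbar T)%:R) = L * (Delta * (Nbar T)%:R).
      by field; rewrite gt_eqF.
    by rewrite ler_pM2l// NT// ltW.
  have [u0 hu] := hinvK y0; set u := hinv y in u0 hu *.
  have u1 : u <= 1.
    rewrite leNgt; apply/negP => u1; have := le_hfun (@ltr01 R) (ltW u1).
    rewrite hu leNgt => /negP; apply; apply: le_lt_trans yT _.
    rewrite ltr_pdivrMr// [ltRHS]mulrC -ltr_pdivrMr ?hfun_gt0//.
    by near: T; apply: nbhs_pinfty_gt; exact: num_real.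
  have uA : u <= (A / T) `^ s^-1.
    apply: le_powR_inv; rewrite ?(ltW u0)//.
    apply: le_trans (hD u _) _; first by rewrite u0.
    by rewrite hu /A -mulrA ler_pM2l.
  apply: (@le_trans _ _ ((A / T) `^ (s^-1 / p) * (B * T `^ k))).
    rewrite powRrM ler_pM ?powR_ge0//.
    by apply: ge0_ler_powR; rewrite ?nnegrE ?powR_ge0 ?invr_ge0 ?(ltW p0) ?(ltW u0).
  rewrite powR_div ?(ltW A0) ?(ltW T_gt0)// opprB.
  rewrite powRD ?(gt_eqF T_gt0) ?implybT// powRN.
  by rewrite le_eqVlt; apply/orP; left; apply/eqP; ring.
- by apply: outer => //; rewrite ltr0n.
Unshelve. all: by end_near. Qed.

End radius.

(** * Concentration at the radius *)

Section constant_sample.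
Context {R : realType} {d : nat} (mu : probability (borel R d) R) (a : 'rV[R]_d).
Hypothesis mu_a : mu [set a] = 1%E.

Lemma point_mass A : measurable A -> mu A = (\d_(a : borel R d) A)%E.
Proof.
move=> mA; have ma := borel_set1 a; rewrite diracE.
case: (boolP (a \in A)) => [/set_mem aA|/negP aA] /=.
  apply/eqP; rewrite eq_le probability_le1//= -mu_a; apply: le_measure; rewrite ?inE//.
  by move=> _ ->.
apply/eqP; rewrite eq_le measure_ge0 andbT.
apply: (@le_trans _ _ (mu (~` [set a]))); last by rewrite probability_setC// mu_a subee.
apply: le_measure; rewrite ?inE//; first exact: measurableC.
by move=> x Ax xa; apply: aA; rewrite inE -xa.
Qed.

Lemma transport_cost_constant p N : 0 < p -> (0 < N)%N ->
  transport_cost p (empirical N (fun=> a : borel R d)) mu = 0%E.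
Proof.
move=> p0 N0; apply/eqP; rewrite eq_le transport_cost_ge0 andbT.
pose aa : borel R d * borel R d := (a, a).
apply: ge_ereal_inf; exists (plan_cost p (\d_aa : probability _ R)).
  exists (\d_aa : probability _ R) => //= A mA; split.
    rewrite /pushforward /empirical /mscale/= /msum/= !diracE.
    rewrite sumEFin sumr_const card_ord -EFinM -(mulr_natr (a \in A)%:R N).
    rewrite mulrCA mulVf ?mulr1//.
    by rewrite pnatr_eq0 -lt0n.
  by rewrite point_mass// /pushforward !diracE.
rewrite /plan_cost integral_dirac//=; last first.
  by apply/measurable_EFinP; exact: measurable_cost.
by rewrite diracT mul1e subrr enorm0 powR0 ?gt_eqF.
Qed.
End constant_sample.

Lemma iid_map (R : realType) (d : nat) (dO : measure_display)
    (Omega : measurableType dO) (P : probability Omega R) (N : nat)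
    (X : nat -> Omega -> borel R d) (mu : set (borel R d) -> \bar R)
    (f : borel R d -> borel R d) :
  measurable_fun setT f -> iid P N X mu ->
  iid P N (fun i w => f (X i w)) (pushforward mu f).
Proof.
move=> mf [mX lawX indX]; have mpre A : measurable A -> measurable (f @^-1` A).
  by move=> mA; rewrite -[X in measurable X]setTI; exact: mf.
split=> [i iN|i iN A mA|B mB]; first exact: measurableT_comp mf (mX i iN).
  by rewrite -[RHS](lawX i iN)//; exact: mpre.
exact: (indX (fun i => f @^-1` B i)) (fun i => mpre _ (mB i)).
Qed.

Section concentration.
Context {R : realType} {d : nat} (p C c beta : R).
Hypotheses (d0 : (0 < d)%N) (p1 : 1 <= p) (C0 : 0 < C) (c0 : 0 < c)
  (beta0 : 0 < beta) (hconc : concentration d p C c).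
Context (dO : measure_display) (Omega : measurableType dO)
  (P : probability Omega R) (mu : probability (borel R d) R) (N : nat)
  (X : nat -> Omega -> borel R d).
Hypotheses (N0 : (0 < N)%N) (iidX : iid P N X mu).

Let p0 : 0 < p. Proof. exact: lt_le_trans p1. Qed.

Let emp w := empirical N (fun i => X i w).

Lemma wasserstein_leE (nu1 nu2 : set (borel R d) -> \bar R) e : 0 <= e ->
  (wasserstein p nu1 nu2 <= e%:E)%E = (transport_cost p nu1 nu2 <= (e `^ p)%:E)%E.
Proof.
move=> e0; apply/idP/idP => h.
  rewrite -(wasserstein_powR _ _ p0) -poweR_EFin; apply: gt0_ler_poweR => //.
  - exact: ltW.
  - by rewrite in_itv/= leey poweR_ge0.
  - by rewrite in_itv/= leey lee_fin e0.
have -> : e = (e `^ p) `^ p^-1 by rewrite -powRrM mulfV ?gt_eqF// powRr1.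
rewrite wassersteinE -poweR_EFin; apply: gt0_ler_poweR => //.
- by rewrite invr_ge0 ltW.
- by rewrite in_itv/= leey transport_cost_ge0.
- by rewrite in_itv/= leey lee_fin powR_ge0.
Qed.

Lemma measurable_wasserstein_le e : 0 <= e ->
  measurable [set w | (wasserstein p (emp w) mu <= e%:E)%E].
Proof.
move=> e0; under eq_set do rewrite wasserstein_leE//.
by apply: measurable_transport_cost_le => // i iN; case: iidX => + _ _; exact.
Qed.

(** When the law is a point mass, almost every sample is constant and equal to
that point, and the two measures coincide. *)
Lemma wasserstein_point_mass a e : 0 <= e -> mu [set a] = 1%E ->
  P [set w | (wasserstein p (emp w) mu <= e%:E)%E] = 1%E.
Proof.
move=> e0 mua; have [mX lawX indX] := iidX.
have m1 : measurable ([set a] : set (borel R d)) by exact: borel_set1.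
pose E := [set w | forall i, (i < N)%N -> [set a] (X i w)].
have mE : measurable E.
  have -> : E = \bigcap_(i in [set i | (i < N)%N]) (X i @^-1` [set a]) by [].
  apply: bigcap_measurableType => i iN.
  by rewrite -[X in measurable X]setTI; exact: mX.
have PE : P E = 1%E.
  rewrite /E (indX (fun=> [set a]))// big1// => i _.
  by rewrite -mua; exact: lawX.
apply/eqP; rewrite eq_le; apply/andP; split.
  by apply: probability_le1; exact: measurable_wasserstein_le.
rewrite -[leLHS]PE.
apply: le_measure; rewrite ?inE//; first exact: measurable_wasserstein_le.
move=> w Ew /=; rewrite wasserstein_leE// /emp.
rewrite (eq_empirical (y := fun=> a)); last by move=> i /Ew.
by rewrite transport_cost_constant// lee_fin powR_ge0.
Qed.

(** Either the support is a point, or the concentration inequality applies at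
every level above the [p]-th power of the radius; continuity of the
probability then gives the bound at the radius itself, even if it is [0]. *)
Lemma concentration_radius (K : set 'rV[R]_d) : compact K -> mu K = 1%E ->
  ((1 - beta)%:E <= P [set w | (wasserstein p (emp w) mu <=
    (ambiguity_radius d p C c N beta (diam K / 2))%:E)%E])%E.
Proof.
move=> cK muK; set rad := ambiguity_radius _ _ _ _ _ _ _.
have rad0 : 0 <= rad by apply: radius_ge0 => //; rewrite divr_ge0 ?diam_ge0.
have SK : measure_support mu `<=` K.
  by apply: support_sub => //; apply: compact_closed => //; exact: norm_hausdorff.
have cS : compact (measure_support mu).
  by apply: subclosed_compact cK SK; exact: closed_support.
have [a Sa] : measure_support mu !=set0.
  apply/set0P/eqP => S0; have := support_full mu; rewrite S0 measure0 => /eqP.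
  by rewrite eqe eq_sym oner_eq0.
have [rs0|rs0] := leP (diam (measure_support mu) / 2) 0.
  rewrite (@wasserstein_point_mass a)//; first by rewrite lee_fin lerBlDr lerDl ltW.
  rewrite -(support_full mu); congr (mu _); apply/esym.
  apply/seteqP; split=> [x Sx|_ ->//] /=; apply/eqP; rewrite -subr_eq0 -normr_eq0.
  rewrite eq_le normr_ge0 andbT (le_trans (norm_le_diam cS Sx Sa))//.
  by rewrite -(pmulr_lle0 _ (_ : 0 < 2^-1)) ?invr_gt0.
have mX i : (i < N)%N -> measurable_fun setT (X i) by case: iidX => + _ _; exact.
pose A n := [set w | (transport_cost p (emp w) mu < (rad `^ p + n.+1%:R^-1)%:E)%E].
have mA n : measurable (A n) by exact: measurable_transport_cost_lt.
have PA n : ((1 - beta)%:E <= P (A n))%E.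
  have e0 : 0 < rad `^ p + n.+1%:R^-1 by rewrite ltr_wpDl ?powR_ge0// invr_gt0.
  have := hconc N0 iidX cS rs0 e0.
  have -> : [set w | ((rad `^ p + n.+1%:R^-1)%:E <=
      wasserstein p (emp w) mu `^ p)%E] = ~` A n.
    by apply/seteqP; split=> w /=; rewrite wasserstein_powR// leNgt => /negP.
  rewrite probability_setC// => PAn.
  have : (1 - P (A n) <= beta%:E)%E.
    apply: le_trans PAn _; rewrite lee_fin.
    apply: (@chi_le _ _ _ _ _ _ d0 p1 C0 c0 beta0 _ _ _ (diam K / 2)) => //.
      by rewrite ler_pM2r ?invr_gt0// le_diam.
    by rewrite lerDl invr_ge0.
  have Pfin : P (A n) \is a fin_num by exact: fin_num_measure.
  rewrite -(fineK Pfin) -EFinB !lee_fin => h.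
  by rewrite lerBlDr addrC -lerBlDr.
have -> : [set w | (wasserstein p (emp w) mu <= rad%:E)%E] = \bigcap_n A n.
  apply/seteqP; split=> w /=; rewrite wasserstein_leE//.
    by move=> h n _; rewrite /A/= (le_lt_trans h)// lte_fin ltrDl invr_gt0.
  move=> h; apply/lee_addgt0Pr => e e0.
  have /filter_ex[n hn] := near_infty_natSinv_lt (PosNum e0).
  by rewrite (le_trans (ltW (h n I)))// -EFinD lee_fin lerD2l ltW.
have cvgA : P (A n) @[n --> \oo] --> P (\bigcap_n A n).
  apply: nonincreasing_cvg_mu => //.
  - by rewrite -ge0_fin_numE// fin_num_measure.
  - exact: bigcapT_measurable.
  - apply/nonincreasing_seqP => n; apply/subsetPset => w /= /lt_le_trans; apply.
    by rewrite lee_fin lerD2l lef_pV2 ?posrE// ler_nat.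
rewrite -(cvg_lim _ cvgA)//; apply: lime_ge; last exact: nearW.
by apply/cvg_ex; exists (P (\bigcap_n A n)).
Qed.

End concentration.

(** * Sampling times and the main theorem *)

Lemma sampling_horizon_le (R : realType) (T Delta : R) (N : nat) (tau : nat -> R) :
  sampling_times T Delta N tau -> 0 < Delta -> T <= Delta * N%:R.
Proof.
move=> [N0 tau0 tauT step] Delta0.
have le_tau i : (i < N)%N -> tau i <= Delta * i%:R.
  elim: i => [_|i IH iN]; first by rewrite tau0 mulr0.
  have [_ h] := step i iN; have := IH (ltnW iN).
  by rewrite -natr1 mulrDr mulr1; lra.
rewrite -tauT; apply: le_trans (le_tau N.-1 _) _; first by rewrite prednK.
by rewrite ler_wpM2l ?(ltW Delta0)// ler_nat leq_pred.
Qed.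

Lemma sampling_times_itv (R : realType) (T Delta : R) (N : nat) (tau : nat -> R) :
  sampling_times T Delta N tau -> forall i, (i < N)%N -> 0 <= tau i <= T.
Proof.
move=> [N0 tau0 tauT step].
have mono j k : (j + k < N)%N -> tau j <= tau (j + k)%N.
  elim: k => [_|k IH]; first by rewrite addn0.
  rewrite addnS => jkN; apply: le_trans (IH (ltnW jkN)) _.
  by case: (step _ jkN).
move=> i iN; have iN1 : (i <= N.-1)%N by rewrite -ltnS prednK.
have lastN : (N.-1 < N)%N by rewrite ltn_predL.
apply/andP; split; first by rewrite -tau0 (mono 0%N i).
by rewrite -tauT -(subnKC iN1) mono// subnKC.
Qed.

Theorem mainTheorem1
  (R : realType) (d : nat) (hd : (0 < d)%N)
  (F : R -> 'rV[R]_d -> 'rV[R]_d)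
  (hFcont : continuous_field F)
  (hFlip : locally_lipschitz_field F)
  (hFcomplete : forward_complete F)
  (alpha : R -> R) (halpha : locally_integrable_ge0 alpha)
  (V : 'rV[R]_d -> R) (hV : C1 V)
  (a1 a2 r M1 q : R)
  (ha1 : 0 < a1) (ha2 : 0 < a2) (hr : 1 < r) (hM1 : 0 <= M1) (hq : q < 1)
  (hVbounds : forall xi : 'rV[R]_d,
    a1 * enorm xi `^ r <= V xi /\ V xi <= a2 * enorm xi `^ r)
  (hVdecay : forall (t : R) (xi : 'rV[R]_d), 0 <= t -> xi <> 0 ->
    'd V xi (F t xi) <= alpha t * V xi + M1 * V xi `^ q)
  (P0 : probability (borel R d) R)
  (K : set 'rV[R]_d) (hK : compact K) (hP0K : P0 K = 1%E)
  (beta p : R) (hbeta0 : 0 < beta) (hbeta1 : beta < 1) (hp : 1 <= p)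
  (hab :
    [/\ 0 < M1,
        exists2 M2 : R, 0 < M2 & forall s1 s2 : R, 0 <= s1 -> s1 <= s2 ->
          \int[lebesgue_measure]_(t in `[s1, s2]) alpha t <= M2 &
        Num.max (2 * p) d%:R < r * (1 - q)]
    \/
    (M1 = 0 /\
     exists q' t0 : R,
       [/\ 0 < q', 0 < t0, Num.max (2 * p) d%:R < r * q' &
           forall t : R, t0 <= t ->
             \int[lebesgue_measure]_(s in `[0, t]) alpha s <= ln t / q']))
  (C c : R) (hC : 0 < C) (hc : 0 < c) (hconc : concentration d p C c)
  (Delta : R) (hDelta : 0 < Delta)
  (Nbar : R -> nat) (tau : R -> nat -> R)
  (htau : forall T : R, 0 <= T -> sampling_times T Delta (Nbar T) (tau T))
  (dO : measure_display) (Omega : measurableType dO)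
  (P : probability Omega R)
  (xi0 : R -> nat -> Omega -> borel R d)
  (hxi0 : forall T : R, 0 <= T -> iid P (Nbar T) (xi0 T) P0) :
  let rho := fun T : R => diam (flow F T 0 @` K) / 2 in
  let xi := fun (T : R) (i : nat) (t : R) (w : Omega) =>
    flow F t 0 (xi0 T i w) in
  let PT := fun T : R => pushforward P0 (flow F T 0 : borel R d -> borel R d) in
  let PbarT := fun (T : R) (w : Omega) =>
    empirical (Nbar T) (fun i => flow F T (tau T i) (xi T i (tau T i) w)) in
  (forall T : R, 0 <= T ->
     (P [set w | wasserstein p (PbarT T w) (PT T) <=
                 (ambiguity_radius d p C c (Nbar T) beta (rho T))%:E] >=
      (1 - beta)%:E)%E)
  /\
  ambiguity_radius d p C c (Nbar T) beta (rho T) @[T --> +oo] --> (0 : R).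
Proof.
move=> rho xi PT PbarT.
have flow_cont T : 0 <= T -> continuous (flow F T 0).
  by move=> T0; exact: flow_continuous.
have compact_image T : 0 <= T -> compact (flow F T 0 @` K).
  move=> T0; apply: continuous_compact hK; apply: continuous_subspaceT.
  exact: flow_cont.
have mflow T : 0 <= T -> measurable_fun setT (flow F T 0 : borel R d -> borel R d).
  by move=> T0; apply: continuous_borel; exact: flow_cont.
split=> [T T0|].
  have [Q [QE _]] := pushforward_probability P0 (mflow T T0).
  have {}QE : PT T = Q :> (set (borel R d) -> \bar R).
    by apply/funext => A; rewrite QE.
  have iidX : iid P (Nbar T) (fun i w => flow F T 0 (xi0 T i w)) Q.
    by rewrite -QE; exact: iid_map (mflow T T0) (hxi0 T T0).
  have [N0 _ _ _] := htau T T0.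
  have mK : measurable (K : set (borel R d)).
    by apply: closed_borel; apply: compact_closed => //; exact: norm_hausdorff.
  have QK : Q (flow F T 0 @` K) = 1%E.
    have mFK : measurable (flow F T 0 @` K : set (borel R d)).
      apply: closed_borel; apply: compact_closed; first exact: norm_hausdorff.
      exact: compact_image.
    apply/eqP; rewrite eq_le probability_le1//= -hP0K -QE; apply: le_measure.
    - by rewrite inE.
    - by rewrite inE -[X in measurable X]setTI; exact: mflow.
    - by move=> x Kx; exists x.
  have := concentration_radius hd hp hC hc hbeta0 hconc N0 iidX (compact_image T T0) QK.
  rewrite QE (_ : [set w | _] = [set w | (wasserstein p (PbarT T w) Q <=
     (ambiguity_radius d p C c (Nbar T) beta (rho T))%:E)%E])//.
  apply/funext => w; congr (_ <= _)%E; congr (wasserstein p _ _).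
  apply: eq_empirical => i iN.
  have /andP[t0 tT] := sampling_times_itv (htau T T0) iN.
  by rewrite /xi flow_semigroup.
have [k [B [T1 [k0 km B0 growth]]]] := rho_growth hFcont hFlip hFcomplete halpha
  hV ha1 hr hM1 hq hVbounds hVdecay hK hab.
apply: (@radius_cvg _ _ _ _ _ _ hd hp hc _ _ Delta k B (Num.max 0 T1)) => //.
  by move=> T T0; exact: sampling_horizon_le (htau T T0) hDelta.
move=> T; rewrite ge_max => /andP[T0 T1T]; rewrite growth// andbT.
by rewrite divr_ge0 ?diam_ge0//; exact: compact_image.
Qed.
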